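(* Let $0<J_{min}\le J_{max}$ be given, let $k_1>0$, $k_2>0$, $\alpha>0$, $\lambda>0$, and let $\Gamma^i(t)$ be the matrix function obtained from the dipole geomagnetic field along a circular orbit as described in the context. Assume that $\Gamma^i_{av}=\lim_{T\to\infty}\frac1T\int_0^T\Gamma^i(\tau)\,d\tau$ is positive definite, $\Gamma^i_{av}>0$. Then there exists $\epsilon^*>0$ such that for every inertia matrix $J$ (symmetric positive definite, $J\in\mathbb{R}^{3\times3}$) satisfying $$J_{min}\le\lambda_{min}(J)\le\lambda_{max}(J)=\|J\|\le J_{max}$$ and every $0<\epsilon<\epsilon^*$, the equilibrium $(q,\omega,\delta)=(\bar q,0,\frac{1}{\epsilon\lambda}\bar q)$, with $\bar q=[0\ 0\ 0\ 1]^T$, is locally exponentially stable for the closed-loop system on $\{q\in\mathbb{R}^4:\|q\|=1\}\times\mathbb{R}^3\times\mathbb{R}^4$ given by $$\dot q=W(q)\omega,\qquad J\dot\omega=-\omega^{\times}J\omega+A(q)\Gamma^i(t)A(q)^Tu,$$ with the dynamic attitude feedback control law $$\dot\delta=\alpha(q-\epsilon\lambda\delta),\qquad u=-\epsilon^2\left(k_1q_v+k_2\alpha\lambda W(q)^T(q-\epsilon\lambda\delta)\right),$$ where $\delta\in\mathbb{R}^4$.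
   Context: Notation. $\|\cdot\|$ is the Euclidean norm of a vector and the induced 2-norm of a matrix; $\lambda_{min}(\cdot),\lambda_{max}(\cdot)$ are minimum and maximum eigenvalues (while $\lambda$ alone is a scalar controller gain); $I$ is the identity matrix. For $a\in\mathbb{R}^3$, $a^{\times}\in\mathbb{R}^{3\times 3}$ is the skew-symmetric matrix with $a^{\times}b=a\times b$ for all $b\in\mathbb{R}^3$. Attitude. A unit quaternion is $q=[q_1\ q_2\ q_3\ q_4]^T=[q_v^T\ q_4]^T$ with $q_v\in\mathbb{R}^3$, $\|q\|=1$; it represents the rotation of the body frame with respect to the inertial frame. $\omega\in\mathbb{R}^3$ is the angular rate in body frame. Define $$A(q)=(q_4^2-q_v^Tq_v)I+2q_vq_v^T-2q_4q_v^{\times},\qquad W(q)=\frac12\begin{bmatrix}q_4I+q_v^{\times}\\-q_v^T\end{bmatrix}.$$ Geomagnetic field. The spacecraft follows a circular orbit of radius $R>0$, orbital rate $n>0$, initial phase $\phi_0$, inclination $incl$ and right ascension of the ascending node $\Omega$. Its in-plane position is $x^p(t)=R\cos(nt+\phi_0)$, $y^p(t)=R\sin(nt+\phi_0)$, and its inertial position is $r^i(t)=R_z(\Omega)R_x(incl)[x^p(t)\ y^p(t)\ 0]^T$, where $$R_z(\Omega)=\begin{bmatrix}\cos\Omega&-\sin\Omega&0\\ \sin\Omega&\cos\Omega&0\\0&0&1\end{bmatrix},\quad R_x(incl)=\begin{bmatrix}1&0&0\\0&\cos(incl)&-\sin(incl)\\0&\sin(incl)&\cos(incl)\end{bmatrix}.$$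 Let $\hat r^i(t)=r^i(t)/\|r^i(t)\|$. The Earth's dipole direction is $$\hat m^i(t)=[\sin\theta_m\cos(\omega_et+\alpha_0),\ \sin\theta_m\sin(\omega_et+\alpha_0),\ \cos\theta_m]^T,$$ with dipole coelevation $\theta_m$, Earth rotation rate $\omega_e=360.99$ deg/day, and initial right ascension $\alpha_0$. With total dipole strength $\mu_m>0$, the geomagnetic field at the spacecraft in the inertial frame is $$B^i(t)=\frac{\mu_m}{\|r^i(t)\|^3}\left[3(\hat m^i(t)^T\hat r^i(t))\hat r^i(t)-\hat m^i(t)\right],$$ and $$\Gamma^i(t)=(B^i(t)^{\times})(B^i(t)^{\times})^T=B^i(t)^TB^i(t)I-B^i(t)B^i(t)^T.$$ Each entry of $\Gamma^i(t)$ is a finite linear combination of sinusoidal functions of $t$ (and constants), so the average $\Gamma^i_{av}$ is well defined. Local exponential stability of an equilibrium $\bar x$ of a time-varying system means: there exist positive constants $c,k,\gamma$ such that for all initial times $t_0\ge0$ and all initial states in the state space with $\|x(t_0)-\bar x\|<c$, the solution satisfies $\|x(t)-\bar x\|\le k\|x(t_0)-\bar x\|e^{-\gamma(t-t_0)}$ for all $t\ge t_0$. *)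

(* Defs.v *)
From HB Require Import structures.
From mathcomp Require Import all_boot all_order all_algebra.
From mathcomp Require Import all_classical all_reals all_analysis.

Set Implicit Arguments.
Unset Strict Implicit.
Unset Printing Implicit Defensive.

Import Order.TTheory GRing.Theory Num.Theory.
Import numFieldNormedType.Exports.

Local Open Scope classical_set_scope.
Local Open Scope ring_scope.

Section LinearAlgebra.
Variable K : realType.

Definition dot n (u v : 'cV[K]_n) : K := (u^T *m v) 0 0.

(* The norm `|u| that the library puts on matrices is the max norm; the
   Euclidean norm is needed here. *)
Definition enorm n (u : 'cV[K]_n) : K := Num.sqrt (dot u u).

Definition opnorm m n (A : 'M[K]_(m, n)) : K :=
  sup [set enorm (A *m u) | u in [set u : 'cV[K]_n | enorm u = 1]].

Definition posdef n (A : 'M[K]_n) : Prop :=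
  A^T = A /\ forall u : 'cV[K]_n, u != 0 -> 0 < dot u (A *m u).

(* Meaningful when the set of real eigenvalues is nonempty, e.g. for a
   symmetric A of positive size; inf and sup are then attained. *)
Definition lambda_min n (A : 'M[K]_n) : K := inf [set a | eigenvalue A a].
Definition lambda_max n (A : 'M[K]_n) : K := sup [set a | eigenvalue A a].

Definition vec3 (x y z : K) : 'cV[K]_3 := \col_i [:: x; y; z]`_i.

Definition mat3 (r1 r2 r3 : seq K) : 'M[K]_3 :=
  \matrix_(i, j) (nth [::] [:: r1; r2; r3] i)`_j.

(* crossmx a *m b is the cross product of a and b *)
Definition crossmx (a : 'cV[K]_3) : 'M[K]_3 :=
  let a1 := a 0 0 in let a2 := a 1 0 in let a3 := a 2%:R 0 in
  mat3 [::    0; - a3;   a2]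
       [::   a3;    0; - a1]
       [:: - a2;   a1;    0].

End LinearAlgebra.

Section Stability.
Variables (K : realType) (n : nat).

(* A time-varying system on the state space X is given in implicit form:
   F t x v says that v is an admissible velocity at time t in state x.
   At t0 itself only (right) continuity is required of a solution; the
   one-sided differential equation at t0 follows when the velocity depends
   continuously on (t, x). *)
Definition solution (F : K -> 'cV[K]_n -> 'cV[K]_n -> Prop)
    (X : set 'cV[K]_n) (t0 : K) (x0 : 'cV[K]_n) (x : K -> 'cV[K]_n) : Prop :=
  [/\ x t0 = x0,
      {within `[t0, +oo[, continuous x},
      forall t, t0 <= t -> X (x t) &
      forall t, t0 < t -> derivable x t 1 /\ F t (x t) ('D_1 x t)].

(* "The solution" is read as: a solution exists on [t0, +oo[, and every
   solution satisfies the bound. For x0 = xbar this makes xbar an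
   equilibrium. *)
Definition locally_exponentially_stable
    (F : K -> 'cV[K]_n -> 'cV[K]_n -> Prop) (X : set 'cV[K]_n)
    (xbar : 'cV[K]_n) : Prop :=
  exists c k gamma : K, [/\ 0 < c, 0 < k, 0 < gamma &
    forall (t0 : K) (x0 : 'cV[K]_n),
      0 <= t0 -> X x0 -> enorm (x0 - xbar) < c ->
      (exists x, solution F X t0 x0 x) /\
      (forall x, solution F X t0 x0 x -> forall t, t0 <= t ->
         enorm (x t - xbar) <=
           k * enorm (x0 - xbar) * expR (- gamma * (t - t0)))].

End Stability.

Section GeomagneticField.
Variable K : realType.

Definition Rz (a : K) : 'M[K]_3 :=
  mat3 [:: cos a; - sin a; 0]
       [:: sin a;   cos a; 0]
       [::     0;       0; 1].

Definition Rx (a : K) : 'M[K]_3 :=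
  mat3 [:: 1;     0;       0]
       [:: 0; cos a; - sin a]
       [:: 0; sin a;   cos a].

(* 360.99 deg/day in rad/s; time is measured in seconds *)
Definition omega_e : K :=
  (360%:R + 99%:R / 100%:R) * (pi / 180%:R) / (24%:R * 60%:R * 60%:R).

Record orbit_dipole := OrbitDipole {
  orbit_radius : K;
  orbit_rate : K;
  phi0 : K;
  inclination : K;
  raan : K;
  mu_m : K;
  theta_m : K;
  alpha0 : K;
  orbit_radius_gt0 : 0 < orbit_radius;
  orbit_rate_gt0 : 0 < orbit_rate;
  mu_m_gt0 : 0 < mu_m }.

Variable o : orbit_dipole.

Definition position (t : K) : 'cV[K]_3 :=
  Rz (raan o) *m Rx (inclination o) *m
  vec3 (orbit_radius o * cos (orbit_rate o * t + phi0 o))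
       (orbit_radius o * sin (orbit_rate o * t + phi0 o))
       0.

Definition position_dir (t : K) : 'cV[K]_3 :=
  (enorm (position t))^-1 *: position t.

Definition dipole_dir (t : K) : 'cV[K]_3 :=
  vec3 (sin (theta_m o) * cos (omega_e * t + alpha0 o))
       (sin (theta_m o) * sin (omega_e * t + alpha0 o))
       (cos (theta_m o)).

Definition Bfield (t : K) : 'cV[K]_3 :=
  (mu_m o / enorm (position t) ^+ 3) *:
    ((3%:R * dot (dipole_dir t) (position_dir t)) *: position_dir t
     - dipole_dir t).

Definition Gamma (t : K) : 'M[K]_3 := crossmx (Bfield t) *m (crossmx (Bfield t))^T.

Definition Gamma_av : 'M[K]_3 :=
  \matrix_(i, j)
    lim ((T^-1 * \int[lebesgue_measure]_(tau in `[0, T]) Gamma tau i j)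
           @[T --> +oo]).

End GeomagneticField.

Section ClosedLoop.
Variable K : realType.

Definition vpart (q : 'cV[K]_4) : 'cV[K]_3 := usubmx (q : 'cV[K]_(3 + 1)).
Definition spart (q : 'cV[K]_4) : K := dsubmx (q : 'cV[K]_(3 + 1)) 0 0.

Definition Amx (q : 'cV[K]_4) : 'M[K]_3 :=
  let qv := vpart q in let q4 := spart q in
  (q4 ^+ 2 - dot qv qv)%:M + 2%:R *: (qv *m qv^T) - (2%:R * q4) *: crossmx qv.

Definition Wmx (q : 'cV[K]_4) : 'M[K]_(4, 3) :=
  2%:R^-1 *: (col_mx ((spart q)%:M + crossmx (vpart q)) (- (vpart q)^T)
                : 'M[K]_(3 + 1, 3)).

Definition qbar : 'cV[K]_4 := col_mx (0 : 'cV[K]_3) (1 : 'cV[K]_1).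

(* The state (q, omega, delta) is stacked in a column of size 4 + 3 + 4, so
   that enorm is the Euclidean norm on R^11. *)
Definition state (q : 'cV[K]_4) (w : 'cV[K]_3) (d : 'cV[K]_4) :
  'cV[K]_(4 + 3 + 4) := col_mx (col_mx q w) d.

Definition state_q (x : 'cV[K]_(4 + 3 + 4)) : 'cV[K]_4 := usubmx (usubmx x).
Definition state_w (x : 'cV[K]_(4 + 3 + 4)) : 'cV[K]_3 := dsubmx (usubmx x).
Definition state_d (x : 'cV[K]_(4 + 3 + 4)) : 'cV[K]_4 := dsubmx x.

Definition state_space : set 'cV[K]_(4 + 3 + 4) :=
  [set x | enorm (state_q x) = 1].

Definition control (k1 k2 alpha lambda eps : K) (q d : 'cV[K]_4) : 'cV[K]_3 :=
  - (eps ^+ 2 *: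
     (k1 *: vpart q +
      (k2 * alpha * lambda) *: ((Wmx q)^T *m (q - (eps * lambda) *: d)))).

Definition closed_loop (G : K -> 'M[K]_3) (J : 'M[K]_3)
    (k1 k2 alpha lambda eps : K) (t : K) (x v : 'cV[K]_(4 + 3 + 4)) : Prop :=
  let q := state_q x in let w := state_w x in let d := state_d x in
  let u := control k1 k2 alpha lambda eps q d in
  [/\ state_q v = Wmx q *m w,
      J *m state_w v
        = - (crossmx w *m (J *m w)) + Amx q *m G t *m (Amx q)^T *m u &
      state_d v = alpha *: (q - (eps * lambda) *: d)].

End ClosedLoop.

(* Main.v *)
Require Import Defs.
From mathcomp Require Import all_boot all_order all_algebra.
From mathcomp Require Import all_classical all_reals all_analysis.
From mathcomp Require Import ring lra.

Set Implicit Arguments.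
Unset Strict Implicit.
Unset Printing Implicit Defensive.

Import Order.TTheory GRing.Theory Num.Theory.
Import numFieldNormedType.Exports.

Local Open Scope classical_set_scope.
Local Open Scope ring_scope.

(** Put z = omega / eps and p = q - eps lambda delta, and let v be the vector
    part of q.  In these coordinates the whole closed loop is of order eps.
    With c = k2 alpha lambda / 2 and w = k1 v + c p, it reads near the
    equilibrium, up to terms quadratic in the state,
      v' = eps z / 2,   p' = eps (z / 2 - alpha lambda p),
      J z' = - eps Gamma(t) w,
    where p now stands for its vector part; the scalar part of p decays by
    itself, and the scalar part of q is determined by v on the unit sphere
    (closed_loop_error_dynamics).

    If Gamma(t) were its mean G, the energy z.Jz / 2 + k1 v.Gv + c p.Gp would
    have the derivative - 2 eps c alpha lambda p.Gp, which damps p only.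
    Adding nu (v - 2 p).Jz with a small nu spreads the damping to z and v
    (averaged_rate_le).  As for the oscillation, Gamma is a trigonometric
    polynomial in t, so Gamma - G has a bounded primitive U
    (Gamma_deviation_primitive), and adding
    eps (z + nu (v - 2 p)).U w to the Lyapunov function replaces Gamma by G in
    its derivative, at the price of terms of order eps ^ 2 (lyap_rate_expand).
    For small eps these, and for a small state the cubic terms, are absorbed by
    the damping (lyap_rate_le).  The inertia matrix enters the estimates only
    through J_min |u|^2 <= u.Ju and |Ju| <= J_max |u|, the first of which comes
    from the variational characterization of the smallest eigenvalue
    (lambda_min_le_rayleigh); hence the threshold on eps does not depend on J.

    A continuity argument keeps trajectories in the region where the estimate
    holds (lyapunov_trap).  It also gives existence: the field saturated
    outside a large box is bounded and Lipschitz, so that its solutions are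
    global (picard_global), and the same decay estimate shows that those
    starting near the equilibrium never feel the saturation. *)

(** * Euclidean norm and quadratic forms *)

Section EuclideanNorm.
Variable K : realType.
Implicit Types (n m : nat) (a b c : K).

Lemma dotE n (u v : 'cV[K]_n) : dot u v = \sum_i u i 0 * v i 0.
Proof. by rewrite /dot mxE; apply: eq_bigr => i _; rewrite mxE. Qed.

Lemma dotC n (u v : 'cV[K]_n) : dot u v = dot v u.
Proof. by rewrite !dotE; apply: eq_bigr => i _; rewrite mulrC. Qed.

Lemma dotDr n (u v w : 'cV[K]_n) : dot u (v + w) = dot u v + dot u w.
Proof. by rewrite /dot mulmxDr mxE. Qed.

Lemma dotZr n a (u v : 'cV[K]_n) : dot u (a *: v) = a * dot u v.
Proof. by rewrite /dot -scalemxAr mxE. Qed.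

Lemma dotNr n (u v : 'cV[K]_n) : dot u (- v) = - dot u v.
Proof. by rewrite /dot mulmxN mxE. Qed.

Lemma dotBr n (u v w : 'cV[K]_n) : dot u (v - w) = dot u v - dot u w.
Proof. by rewrite dotDr dotNr. Qed.

Lemma dotDl n (u v w : 'cV[K]_n) : dot (u + v) w = dot u w + dot v w.
Proof. by rewrite !(dotC _ w) dotDr. Qed.

Lemma dotZl n a (u v : 'cV[K]_n) : dot (a *: u) v = a * dot u v.
Proof. by rewrite !(dotC _ v) dotZr. Qed.

Lemma dotNl n (u v : 'cV[K]_n) : dot (- u) v = - dot u v.
Proof. by rewrite !(dotC _ v) dotNr. Qed.

Lemma dotBl n (u v w : 'cV[K]_n) : dot (u - v) w = dot u w - dot v w.
Proof. by rewrite dotDl dotNl. Qed.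

Lemma dot0r n (u : 'cV[K]_n) : dot u 0 = 0.
Proof. by rewrite /dot mulmx0 mxE. Qed.

Lemma dot0l n (u : 'cV[K]_n) : dot 0 u = 0.
Proof. by rewrite dotC dot0r. Qed.

Definition dot_lin := (dotDl, dotDr, dotBl, dotBr, dotNl, dotNr, dotZl, dotZr).

Lemma dot_mulmx m n (A : 'M[K]_(m, n)) u v : dot u (A *m v) = dot (A^T *m u) v.
Proof. by rewrite /dot trmx_mul trmxK mulmxA. Qed.

Lemma dot_sym n (A : 'M[K]_n) u v : A^T = A -> dot u (A *m v) = dot v (A *m u).
Proof. by move=> sA; rewrite dot_mulmx sA dotC. Qed.

Lemma dot_ge0 n (u : 'cV[K]_n) : 0 <= dot u u.
Proof. by rewrite dotE; apply: sumr_ge0 => i _; rewrite -expr2 sqr_ge0. Qed.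

Lemma dot_eq0 n (u : 'cV[K]_n) : (dot u u == 0) = (u == 0).
Proof.
apply/idP/eqP => [|->]; last by rewrite dot0l.
rewrite dotE psumr_eq0 => [/allP u0|i _]; last by rewrite -expr2 sqr_ge0.
apply/matrixP => i j; rewrite ord1 mxE.
by have := u0 i (mem_index_enum _); rewrite /= -expr2 sqrf_eq0 => /eqP.
Qed.

Lemma enorm_ge0 n (u : 'cV[K]_n) : 0 <= enorm u.
Proof. exact: sqrtr_ge0. Qed.

Lemma sqr_enorm n (u : 'cV[K]_n) : enorm u ^+ 2 = dot u u.
Proof. by rewrite sqr_sqrtr// dot_ge0. Qed.

Lemma enorm_eq0 n (u : 'cV[K]_n) : (enorm u == 0) = (u == 0).
Proof. by rewrite -sqrf_eq0 sqr_enorm dot_eq0. Qed.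

Lemma enorm0 n : enorm (0 : 'cV[K]_n) = 0.
Proof. by apply/eqP; rewrite enorm_eq0. Qed.

Lemma enormZ n a (u : 'cV[K]_n) : enorm (a *: u) = `|a| * enorm u.
Proof.
by rewrite /enorm dotZl dotZr mulrA -expr2 sqrtrM ?sqr_ge0// sqrtr_sqr.
Qed.

Lemma enormN n (u : 'cV[K]_n) : enorm (- u) = enorm u.
Proof. by rewrite -scaleN1r enormZ normrN1 mul1r. Qed.

Lemma enorm_le_sqr n (u : 'cV[K]_n) c : 0 <= c -> dot u u <= c ^+ 2 -> enorm u <= c.
Proof.
by move=> c0 uc; rewrite -(ger0_norm c0) -sqrtr_sqr ler_wsqrtr.
Qed.

Lemma cauchy_schwarz n (u v : 'cV[K]_n) : `|dot u v| <= enorm u * enorm v.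
Proof.
have [->|u0] := eqVneq u 0; first by rewrite dot0l normr0 enorm0 mul0r.
have du0 : 0 < dot u u by rewrite lt_neqAle eq_sym dot_eq0 u0 dot_ge0.
rewrite -(@ler_pXn2r _ 2)// ?nnegrE ?mulr_ge0 ?enorm_ge0//.
rewrite exprMn !sqr_enorm real_normK ?num_real//.
have := dot_ge0 (dot u u *: v - dot u v *: u).
rewrite !dot_lin (dotC v u) => h.
have {}h : 0 <= dot u u * (dot u u * dot v v - dot u v ^+ 2) by lra.
by rewrite pmulr_rge0// subr_ge0 in h.
Qed.

Lemma dot_le n (u v : 'cV[K]_n) : dot u v <= enorm u * enorm v.
Proof. exact: le_trans (ler_norm _) (cauchy_schwarz _ _). Qed.

Lemma enormD n (u v : 'cV[K]_n) : enorm (u + v) <= enorm u + enorm v.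
Proof.
apply: enorm_le_sqr; first by rewrite addr_ge0 ?enorm_ge0.
rewrite sqrrD !sqr_enorm !dot_lin (dotC v u).
by have := dot_le u v; lra.
Qed.

Lemma enormB n (u v : 'cV[K]_n) : enorm (u - v) <= enorm u + enorm v.
Proof. by rewrite -(enormN v); exact: enormD. Qed.

Lemma coord_le_enorm n (u : 'cV[K]_n) i : `|u i 0| <= enorm u.
Proof.
rewrite -sqrtr_sqr ler_wsqrtr// dotE (bigD1 i)//= -expr2 lerDl.
by apply: sumr_ge0 => j _; rewrite -expr2 sqr_ge0.
Qed.

Lemma enorm_le_sum n (u : 'cV[K]_n) : enorm u <= \sum_i `|u i 0|.
Proof.
apply: enorm_le_sqr; first exact: sumr_ge0.
rewrite dotE expr2 mulr_suml; apply: ler_sum => i _.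
rewrite -expr2 -real_normK ?num_real// expr2 ler_wpM2l//.
by rewrite (bigD1 i)//= lerDl sumr_ge0.
Qed.

Lemma enorm_mulmx_entries m n (A : 'M[K]_(m, n)) b u :
  (forall i j, `|A i j| <= b) -> enorm (A *m u) <= (m * n)%:R * b * enorm u.
Proof.
move=> Ab; apply: le_trans (enorm_le_sum _) _.
have entry i : `|(A *m u) i 0| <= n%:R * (b * enorm u).
  rewrite mxE; apply: le_trans (ler_norm_sum _ _ _) _.
  rewrite mulr_natl -[X in _ *+ X]card_ord -sumr_const.
  by apply: ler_sum => j _; rewrite normrM ler_pM// coord_le_enorm.
apply: (le_trans (ler_sum _ (fun i _ => entry i))).
by rewrite sumr_const card_ord -[_ *+ m]mulr_natl natrM !mulrA.
Qed.

Lemma enorm_mulmx_bound m n (A : 'M[K]_(m, n)) :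
  exists2 b, 0 <= b & forall u, enorm (A *m u) <= b * enorm u.
Proof.
exists ((m * n)%:R * \sum_i \sum_j `|A i j|).
  by rewrite mulr_ge0//; apply: sumr_ge0 => i _; exact: sumr_ge0.
move=> u; apply: enorm_mulmx_entries => i j.
rewrite (bigD1 i)//= (bigD1 j)//= -addrA lerDl addr_ge0 ?sumr_ge0// => k _.
exact: sumr_ge0.
Qed.

Lemma sum3E (F : 'I_3 -> K) : \sum_i F i = F 0 + F 1 + F 2%:R.
Proof.
rewrite !big_ord_recl big_ord0 addr0 addrA.
by congr (F _ + F _ + F _); apply: val_inj.
Qed.

Lemma cV3P (u v : 'cV[K]_3) :
  u 0 0 = v 0 0 -> u 1 0 = v 1 0 -> u 2%:R 0 = v 2%:R 0 -> u = v.
Proof.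
move=> e0 e1 e2; apply/matrixP => i j; rewrite ord1.
case: i => [[|[|[|//]]] p].
- by rewrite (_ : Ordinal p = 0)//; apply: val_inj.
- by rewrite (_ : Ordinal p = 1)//; apply: val_inj.
- by rewrite (_ : Ordinal p = 2%:R)//; apply: val_inj.
Qed.

Lemma crossE (a b : 'cV[K]_3) : crossmx a *m b =
  vec3 (a 1 0 * b 2%:R 0 - a 2%:R 0 * b 1 0)
       (a 2%:R 0 * b 0 0 - a 0 0 * b 2%:R 0)
       (a 0 0 * b 1 0 - a 1 0 * b 0 0).
Proof.
by apply: cV3P; rewrite mxE sum3E !mxE /=; ring.
Qed.

Lemma crossmx_tr (a : 'cV[K]_3) : (crossmx a)^T = - crossmx a.
Proof.
apply/matrixP => -[[|[|[|//]]] p] [[|[|[|//]]] q]; rewrite !mxE /= ?oppr0//.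
all: by rewrite opprK.
Qed.

Lemma crossvv (a : 'cV[K]_3) : crossmx a *m a = 0.
Proof. by rewrite crossE; apply: cV3P; rewrite !mxE /=; ring. Qed.

Lemma dot_cross (a b : 'cV[K]_3) : dot a (crossmx a *m b) = 0.
Proof. by rewrite dot_mulmx crossmx_tr mulNmx crossvv oppr0 dot0l. Qed.

Lemma enorm_cross (a b : 'cV[K]_3) : enorm (crossmx a *m b) <= enorm a * enorm b.
Proof.
apply: enorm_le_sqr; first by rewrite mulr_ge0 ?enorm_ge0.
rewrite exprMn !sqr_enorm -subr_ge0.
rewrite (_ : _ - _ = dot a b ^+ 2) ?sqr_ge0// crossE !dotE !sum3E !mxE /=; ring.
Qed.

End EuclideanNorm.

Section Coercivity.
Variables (K : realType) (n : nat).
Implicit Types (A : 'M[K]_n) (u : 'cV[K]_n).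

Lemma sym_injective_unitmx A :
  A^T = A -> (forall u, A *m u = 0 -> u = 0) -> A \in unitmx.
Proof.
move=> sA iA; rewrite -row_free_unit -kermx_eq0; apply/eqP/row_matrixP => i; rewrite row0.
apply: trmx_inj; rewrite trmx0; apply: iA.
by rewrite -{1}sA -trmx_mul -row_mul mulmx_ker row0 trmx0.
Qed.

(** The Cauchy-Schwarz inequality for the semi-inner product of A, applied to
    A u and u, gives |A u|^4 <= (A u).A(A u) * u.Au, hence u.Au dominates
    |A u|^2; and |A u| dominates |u| once A is invertible. *)
Lemma psd_injective_coercive A :
  A^T = A -> (forall u, 0 <= dot u (A *m u)) ->
  (forall u, A *m u = 0 -> u = 0) ->
  exists2 g, 0 < g & forall u, g * dot u u <= dot u (A *m u).
Proof.
move=> sA pA iA.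
have Au := sym_injective_unitmx sA iA.
have [b b0 bA] := enorm_mulmx_bound A.
have [b' b'0 bA'] := enorm_mulmx_bound (invmx A).
have dominated u : dot (A *m u) (A *m u) <= (b + 1) * dot u (A *m u).
  set w := A *m u.
  have cs t : 0 <= dot w (A *m w) - 2%:R * t * dot w w + t ^+ 2 * dot u w.
    have := pA (w - t *: u).
    rewrite mulmxBr -scalemxAr !dot_lin -/w (dot_sym u w sA) -/w.
    by rewrite (_ : dot u w = dot u (A *m u))// -/w; lra.
  have ww : dot w (A *m w) <= b * dot w w.
    apply: le_trans (dot_le _ _) _; rewrite -sqr_enorm expr2 mulrCA.
    by rewrite ler_wpM2l ?enorm_ge0.
  have := cs (b + 1); have := dot_ge0 w; have := pA u; rewrite -/w => puw w0 h.
  have h1 : (b + 1) * dot w w <= (b + 1) * ((b + 1) * dot u w).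
    by have := mulr_ge0 b0 w0; nra.
  by rewrite ler_pM2l// in h1; lra.
exists (((b' + 1) ^+ 2 * (b + 1))^-1).
  by rewrite invr_gt0 mulr_gt0 ?exprn_gt0// ltr_wpDl.
move=> u; rewrite mulrC ler_pdivrMr; last first.
  by rewrite mulr_gt0 ?exprn_gt0// ltr_wpDl.
have uAu : enorm u <= (b' + 1) * enorm (A *m u).
  rewrite -{1}(mul1mx u) -(mulVmx Au) -mulmxA (le_trans (bA' _))//.
  by rewrite ler_wpM2r ?enorm_ge0// lerDl.
apply: (@le_trans _ _ ((b' + 1) ^+ 2 * dot (A *m u) (A *m u))).
  by rewrite -!sqr_enorm -exprMn lerXn2r// nnegrE ?mulr_ge0 ?enorm_ge0 ?addr_ge0.
have := dominated u; have : 0 <= (b' + 1) ^+ 2 by rewrite sqr_ge0.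
by move=> s0 d; have := ler_wpM2l s0 d; rewrite [X in _ <= X]mulrA [X in _ <= X]mulrC.
Qed.

Lemma posdef_injective A : posdef A -> forall u, A *m u = 0 -> u = 0.
Proof.
by move=> [_ pA] u Au; have [//|/pA] := eqVneq u 0; rewrite Au dot0r ltxx.
Qed.

Lemma posdef_coercive A : posdef A ->
  exists2 g, 0 < g & forall u, g * dot u u <= dot u (A *m u).
Proof.
move=> pdA; have [sA pA] := pdA.
apply: psd_injective_coercive => // u; last exact: posdef_injective.
by have [->|/pA/ltW//] := eqVneq u 0; rewrite dot0l.
Qed.

End Coercivity.

Section EigenvalueBounds.
Variables (K : realType) (n : nat).
Implicit Types (A : 'M[K]_n.+1) (u : 'cV[K]_n.+1).

Lemma exists_unit_vector : exists u : 'cV[K]_n.+1, enorm u = 1.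
Proof.
exists (delta_mx 0 0); rewrite /enorm dotE (bigD1 0)//= big1 => [|i i0].
  by rewrite !mxE !eqxx mulr1 addr0 sqrtr1.
by rewrite !mxE (negPf i0) mul0r.
Qed.

(** The infimum mu of the Rayleigh quotient is an eigenvalue: otherwise the
    positive semidefinite matrix A - mu I would be injective, hence coercive,
    and mu could be increased. *)
Lemma lambda_min_le_rayleigh A : posdef A ->
  forall u, lambda_min A * dot u u <= dot u (A *m u).
Proof.
move=> pA; have [sA Agt0] := pA.
have [g g0 gA] := posdef_coercive pA.
pose S := [set dot u (A *m u) | u in [set u : 'cV[K]_n.+1 | enorm u = 1]].
have unitE u : enorm u = 1 -> dot u u = 1 by rewrite -sqr_enorm => ->; rewrite expr1n.
have S0 : S !=set0.
  by have [u u1] := exists_unit_vector; exists (dot u (A *m u)); exists u.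
have lS : lbound S 0.
  by move=> _ [u /= u1 <-]; apply: le_trans (gA u); rewrite mulr_ge0 ?dot_ge0 ?ltW.
have iS : has_inf S by split => //; exists 0.
pose mu := inf S.
have muA u : mu * dot u u <= dot u (A *m u).
  have [->|u0] := eqVneq u 0; first by rewrite mulmx0 !dot0r mulr0.
  have nu0 : 0 < enorm u by rewrite lt_neqAle eq_sym enorm_eq0 u0 enorm_ge0.
  pose v := (enorm u)^-1 *: u.
  have v1 : enorm v = 1 by rewrite enormZ gtr0_norm ?invr_gt0// mulVf ?gt_eqF.
  have uE : u = enorm u *: v by rewrite scalerA mulfV ?gt_eqF// scale1r.
  clearbody v.
  have muv : mu <= dot v (A *m v) by apply: ge_inf; [exists 0|exists v].
  rewrite uE -scalemxAr !dot_lin (unitE v v1) mulr1 !mulrA -expr2 mulrC.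
  by have := ler_wpM2l (sqr_ge0 (enorm u)) muv; lra.
pose M := A - mu%:M.
have ME u : M *m u = A *m u - mu *: u by rewrite mulmxBl mul_scalar_mx.
have sM : M^T = M by rewrite linearB /= sA tr_scalar_mx.
have pM u : 0 <= dot u (M *m u) by rewrite ME !dot_lin subr_ge0.
have ev : eigenvalue A mu.
  apply: contrapT => nev.
  have [//|h h0 hM] := psd_injective_coercive sM pM.
    move=> u; rewrite ME => /eqP; rewrite subr_eq0 => /eqP Au.
    apply: contrapT => /eqP u0; apply: nev; apply/eigenvalueP; exists u^T.
      by rewrite -{1}sA -trmx_mul Au linearZ.
    by rewrite -trmx0 (inj_eq trmx_inj).
  have : mu + h <= mu.
    apply: lb_le_inf => // _ [u /= u1 <-].
    by have := hM u; rewrite ME !dot_lin (unitE u u1); lra.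
  by apply/negP; rewrite -ltNge ltrDl.
move=> u; apply: le_trans (muA u); apply: ler_wpM2r; first exact: dot_ge0.
apply: ge_inf => //; exists 0 => a /eigenvalueP[v vA v0].
have vt0 : v^T != 0 by rewrite -trmx0 (inj_eq trmx_inj).
have := Agt0 _ vt0; rewrite -{1}sA -trmx_mul vA linearZ /= dotZr => h.
rewrite -(pmulr_lge0 (x := dot v^T v^T)) ?ltW//.
by rewrite lt_neqAle eq_sym dot_eq0 vt0 dot_ge0.
Qed.

Lemma enorm_le_opnorm m (A : 'M[K]_(m, n.+1)) u : enorm (A *m u) <= opnorm A * enorm u.
Proof.
have [->|u0] := eqVneq u 0; first by rewrite mulmx0 !enorm0 mulr0.
have nu0 : 0 < enorm u by rewrite lt_neqAle eq_sym enorm_eq0 u0 enorm_ge0.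
have [b b0 bA] := enorm_mulmx_bound A.
rewrite -ler_pdivrMr//; apply: ub_le_sup.
  by exists b => _ [v /= v1 <-]; rewrite (le_trans (bA _))// v1 mulr1.
exists ((enorm u)^-1 *: u) => /=.
  by rewrite enormZ gtr0_norm ?invr_gt0// mulVf ?gt_eqF.
by rewrite -scalemxAr enormZ gtr0_norm ?invr_gt0// mulrC.
Qed.

End EigenvalueBounds.

(** * Derivatives of real functions *)

Section PointwiseDerivatives.
Variable K : realType.
Implicit Types (f g : K -> K) (t a df dg : K).

Lemma derive_pt_cst t a : is_derive t (1 : K) (fun=> a) 0.
Proof. exact: is_derive_cst. Qed.

Lemma derive_pt_id t : is_derive t (1 : K) (fun s => s) 1.
Proof. exact: is_derive_id. Qed.

Lemma derive_ptD f g t df dg : is_derive t 1 f df -> is_derive t 1 g dg ->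
  is_derive t 1 (fun s => f s + g s) (df + dg).
Proof. exact: is_deriveD. Qed.

Lemma derive_ptB f g t df dg : is_derive t 1 f df -> is_derive t 1 g dg ->
  is_derive t 1 (fun s => f s - g s) (df - dg).
Proof. exact: is_deriveB. Qed.

Lemma derive_ptZ f t a df : is_derive t 1 f df ->
  is_derive t 1 (fun s => a * f s) (a * df).
Proof. exact: is_deriveZ. Qed.

Lemma derive_ptM f g t df dg : is_derive t 1 f df -> is_derive t 1 g dg ->
  is_derive t 1 (fun s => f s * g s) (df * g t + f t * dg).
Proof.
move=> hf hg; apply: (is_derive_eq (is_deriveM hf hg)).
by rewrite addrC /GRing.scale /= (mulrC df).
Qed.

Lemma derive_pt_sum n (F : 'I_n -> K -> K) (dF : 'I_n -> K) t :
  (forall i, is_derive t 1 (F i) (dF i)) ->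
  is_derive t 1 (fun s => \sum_i F i s) (\sum_i dF i).
Proof.
move=> hF; rewrite (_ : (fun s => _) = \sum_i F i); first exact: is_derive_sum.
by apply/funext => s; rewrite fct_sumE.
Qed.

Lemma derive_pt_continuous f t df : is_derive t 1 f df -> {for t, continuous f}.
Proof. by case=> fd _; apply/differentiable_continuous/derivable1_diffP. Qed.

Lemma derive_pt_affine (w p t : K) : is_derive t 1 (fun s => w * s + p) w.
Proof.
apply: (is_derive_eq (derive_ptD (derive_ptZ w (derive_pt_id t)) (derive_pt_cst t p))).
by rewrite mulr1 addr0.
Qed.

End PointwiseDerivatives.

(** * Trigonometric polynomials and the geomagnetic field *)

Section TrigonometricPolynomials.
Variable K : realType.
Implicit Types (f g : K -> K).

Inductive trigpoly : (K -> K) -> Prop :=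
| trigpoly_wave a w p : trigpoly (fun t => a * cos (w * t + p))
| trigpolyD f g : trigpoly f -> trigpoly g -> trigpoly (fun t => f t + g t).

Lemma trigpoly_ext f g : f =1 g -> trigpoly f -> trigpoly g.
Proof. by move=> /funext ->. Qed.

Lemma trigpoly_cst a : trigpoly (fun=> a).
Proof.
by apply: trigpoly_ext (trigpoly_wave a 0 0) => t; rewrite mul0r addr0 cos0 mulr1.
Qed.

Lemma trigpoly_cos w p : trigpoly (fun t => cos (w * t + p)).
Proof. by apply: trigpoly_ext (trigpoly_wave 1 w p) => t; rewrite mul1r. Qed.

Lemma trigpoly_sin w p : trigpoly (fun t => sin (w * t + p)).
Proof.
apply: trigpoly_ext (trigpoly_wave 1 w (p - pi / 2%:R)) => t.
by rewrite mul1r addrA cosB cos_pihalf sin_pihalf mulr0 mulr1 add0r.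
Qed.

Lemma trigpolyZ a f : trigpoly f -> trigpoly (fun t => a * f t).
Proof.
elim=> [b w p|g h _ ig _ ih].
  by apply: trigpoly_ext (trigpoly_wave (a * b) w p) => t; rewrite mulrA.
by apply: trigpoly_ext (trigpolyD ig ih) => t; rewrite mulrDr.
Qed.

Lemma trigpolyN f : trigpoly f -> trigpoly (fun t => - f t).
Proof. by move=> hf; apply: trigpoly_ext (trigpolyZ (-1) hf) => t; rewrite mulN1r. Qed.

Lemma trigpolyM f g : trigpoly f -> trigpoly g -> trigpoly (fun t => f t * g t).
Proof.
elim=> [a w p|f1 f2 _ i1 _ i2 hg]; last first.
  by apply: trigpoly_ext (trigpolyD (i1 hg) (i2 hg)) => t; rewrite mulrDl.
elim=> [b v q|g1 g2 _ i1 _ i2]; last first.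
  by apply: trigpoly_ext (trigpolyD i1 i2) => t; rewrite mulrDr.
apply: trigpoly_ext (trigpolyD (trigpoly_wave (a * b / 2%:R) (w + v) (p + q))
                               (trigpoly_wave (a * b / 2%:R) (w - v) (p - q))) => t.
have -> : (w + v) * t + (p + q) = (w * t + p) + (v * t + q) by ring.
have -> : (w - v) * t + (p - q) = (w * t + p) - (v * t + q) by ring.
by rewrite cosD cosB; field.
Qed.

Lemma trigpoly_sum n (F : 'I_n -> K -> K) :
  (forall i, trigpoly (F i)) -> trigpoly (fun t => \sum_i F i t).
Proof.
elim: n F => [|n IH] F hF.
  by apply: trigpoly_ext (trigpoly_cst 0) => t; rewrite big_ord0.
apply: trigpoly_ext (trigpolyD (hF ord0) (IH (fun i => F (lift ord0 i)) _)) => // t.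
by rewrite big_ord_recl.
Qed.

Lemma trigpoly_bounded f : trigpoly f -> exists2 b, 0 <= b & forall t, `|f t| <= b.
Proof.
elim=> [a w p|g h _ [b b0 gb] _ [c c0 hc]].
  exists `|a| => // t; rewrite normrM ler_piMr// ler_norml cos_le1 andbT.
  exact: cos_geN1.
exists (b + c); first exact: addr_ge0.
by move=> t; rewrite (le_trans (ler_normD _ _))// lerD.
Qed.

Lemma trigpoly_continuous f : trigpoly f -> continuous f.
Proof.
elim=> [a w p|g h _ cg _ ch] t; last exact: (cvgD (cg t) (ch t)).
exact: derive_pt_continuous
  (derive_ptZ a (is_derive1_comp (is_derive_cos _) (derive_pt_affine w p t))).
Qed.

(** Subtracting from a trigonometric polynomial its zero-frequency part leaves
    waves of nonzero frequency, whose primitives are again waves. *)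
Lemma trigpoly_primitive f : trigpoly f -> exists (m : K) (F : K -> K),
  (exists2 b, 0 <= b & forall t, `|F t| <= b) /\
  forall t : K, is_derive t 1 F (f t - m).
Proof.
elim=> [a w p|g h _ [m [F [[b b0 Fb] dF]]] _ [m' [F' [[b' b'0 Fb'] dF']]]].
  have [->|w0] := eqVneq w 0.
    exists (a * cos p), (fun=> 0); split; first by exists 0 => // t; rewrite normr0.
    by move=> t; rewrite mul0r add0r subrr; exact: derive_pt_cst.
  exists 0, (fun t => a / w * sin (w * t + p)); split.
    exists `|a / w| => // t; rewrite normrM ler_piMr// ler_norml sin_le1 andbT.
    exact: sin_geN1.
  move=> t; apply: (is_derive_eq (derive_ptZ (a / w)
    (is_derive1_comp (is_derive_sin _) (derive_pt_affine w p t)))).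
  by rewrite subr0 /=; field.
exists (m + m'), (fun t => F t + F' t); split.
  exists (b + b'); first exact: addr_ge0.
  by move=> t; rewrite (le_trans (ler_normD _ _))// lerD.
move=> t; apply: (is_derive_eq (derive_ptD (dF t) (dF' t))).
by ring.
Qed.

(** The integral of f - m over an interval is bounded independently of its length. *)
Lemma average_of_bounded_primitive f m F b : continuous f ->
  (forall t, `|F t| <= b) -> (forall t : K, is_derive t 1 F (f t - m)) ->
  lim ((T^-1 * \int[lebesgue_measure]_(tau in `[0, T]) f tau) @[T --> +oo]) = m.
Proof.
move=> cf Fb dF; apply: cvg_lim => //.
have dG (t : K) : is_derive t 1 (fun s => F s + m * s) (f t).
  apply: (is_derive_eq (derive_ptD (dF t) (derive_ptZ m (derive_pt_id t)))).
  by rewrite mulr1 subrK.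
have intE T : 0 < T -> \int[lebesgue_measure]_(tau in `[0, T]) f tau = F T - F 0 + m * T.
  move=> T0; rewrite /Rintegral (@continuous_FTC2 _ _ (fun s => F s + m * s))//.
  - by rewrite /= mulr0 addr0; ring.
  - exact: continuous_subspaceT.
  - split => [x _||]; first by case: (dG x).
    + by apply: cvg_at_right_filter; exact: (derive_pt_continuous (dG 0)).
    + by apply: cvg_at_left_filter; exact: (derive_pt_continuous (dG T)).
  - by move=> x _; rewrite derive1E; case: (dG x).
apply/cvgrPdist_le => e e0; near=> T.
have T0 : 0 < T by near: T; apply: nbhs_pinfty_gt; rewrite num_real.
have -> : m - T^-1 * \int[lebesgue_measure]_(tau in `[0, T]) f tau = T^-1 * (F 0 - F T).
  by rewrite intE//; field; rewrite gt_eqF.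
rewrite normrM gtr0_norm ?invr_gt0// mulrC ler_pdivrMr//.
rewrite (le_trans (ler_normB _ _))//.
rewrite (@le_trans _ _ (b + b))// ?lerD//.
by rewrite mulrC -ler_pdivrMr//; near: T; apply: nbhs_pinfty_ge; rewrite num_real.
Unshelve. all: by end_near. Qed.

Definition trigpoly_mx m n (M : K -> 'M[K]_(m, n)) :=
  forall i j, trigpoly (fun t => M t i j).

Lemma trigpoly_mx_mul m n p (M : K -> 'M[K]_(m, n)) (N : K -> 'M[K]_(n, p)) :
  trigpoly_mx M -> trigpoly_mx N -> trigpoly_mx (fun t => M t *m N t).
Proof.
move=> hM hN i j; apply: trigpoly_ext (trigpoly_sum (fun k => trigpolyM (hM i k) (hN k j))) => t.
by rewrite mxE.
Qed.

Lemma trigpoly_mx_cst m n (M : 'M[K]_(m, n)) : trigpoly_mx (fun=> M).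
Proof. by move=> i j; exact: trigpoly_cst. Qed.

Lemma trigpoly_mx_tr m n (M : K -> 'M[K]_(m, n)) :
  trigpoly_mx M -> trigpoly_mx (fun t => (M t)^T).
Proof. by move=> hM i j; apply: trigpoly_ext (hM j i) => t; rewrite mxE. Qed.

Lemma trigpoly_mxZ m n (f : K -> K) (M : K -> 'M[K]_(m, n)) :
  trigpoly f -> trigpoly_mx M -> trigpoly_mx (fun t => f t *: M t).
Proof. by move=> hf hM i j; apply: trigpoly_ext (trigpolyM hf (hM i j)) => t; rewrite mxE. Qed.

Lemma trigpoly_mxB m n (M N : K -> 'M[K]_(m, n)) :
  trigpoly_mx M -> trigpoly_mx N -> trigpoly_mx (fun t => M t - N t).
Proof.
move=> hM hN i j.
by apply: trigpoly_ext (trigpolyD (hM i j) (trigpolyN (hN i j))) => t; rewrite !mxE.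
Qed.

Lemma trigpoly_vec3 f g h : trigpoly f -> trigpoly g -> trigpoly h ->
  trigpoly_mx (fun t => vec3 (f t) (g t) (h t)).
Proof.
move=> hf hg hh [[|[|[|//]]] p] j; [apply: trigpoly_ext hf|apply: trigpoly_ext hg|
  apply: trigpoly_ext hh] => t; by rewrite mxE.
Qed.

Lemma trigpoly_crossmx (a : K -> 'cV[K]_3) :
  trigpoly_mx a -> trigpoly_mx (fun t => crossmx (a t)).
Proof.
move=> ha [[|[|[|//]]] p] [[|[|[|//]]] q].
all: by [apply: trigpoly_ext (trigpoly_cst 0) => t; rewrite mxE
  | apply: trigpoly_ext (ha 0 0) => t; rewrite mxE
  | apply: trigpoly_ext (ha 1 0) => t; rewrite mxE
  | apply: trigpoly_ext (ha 2%:R 0) => t; rewrite mxE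
  | apply: trigpoly_ext (trigpolyN (ha 0 0)) => t; rewrite mxE
  | apply: trigpoly_ext (trigpolyN (ha 1 0)) => t; rewrite mxE
  | apply: trigpoly_ext (trigpolyN (ha 2%:R 0)) => t; rewrite mxE ].
Qed.

Lemma trigpoly_dot n (u v : K -> 'cV[K]_n) :
  trigpoly_mx u -> trigpoly_mx v -> trigpoly (fun t => dot (u t) (v t)).
Proof. by move=> hu hv; exact: (trigpoly_mx_mul (trigpoly_mx_tr hu) hv). Qed.

End TrigonometricPolynomials.

Section GeomagneticField.
Variables (K : realType) (o : orbit_dipole K).

Lemma enorm_Rz a (u : 'cV[K]_3) : enorm (Rz a *m u) = enorm u.
Proof.
congr (Num.sqrt _); rewrite !dotE !sum3E !mxE !sum3E !mxE /=.
have := cos2Dsin2 a; set c := cos a; set s := sin a => cs.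
transitivity ((c ^+ 2 + s ^+ 2) * (u 0 0 ^+ 2 + u 1 0 ^+ 2) + u 2%:R 0 ^+ 2); first by ring.
by rewrite cs; ring.
Qed.

Lemma enorm_Rx a (u : 'cV[K]_3) : enorm (Rx a *m u) = enorm u.
Proof.
congr (Num.sqrt _); rewrite !dotE !sum3E !mxE !sum3E !mxE /=.
have := cos2Dsin2 a; set c := cos a; set s := sin a => cs.
transitivity ((c ^+ 2 + s ^+ 2) * (u 1 0 ^+ 2 + u 2%:R 0 ^+ 2) + u 0 0 ^+ 2); first by ring.
by rewrite cs; ring.
Qed.

Lemma enorm_position t : enorm (position o t) = orbit_radius o.
Proof.
rewrite /position -mulmxA enorm_Rz enorm_Rx /enorm dotE sum3E !mxE /=.
have := cos2Dsin2 (orbit_rate o * t + phi0 o).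
set c := cos _; set s := sin _ => cs.
rewrite (_ : _ + _ = orbit_radius o ^+ 2 * (c ^+ 2 + s ^+ 2)); last by ring.
by rewrite cs mulr1 sqrtr_sqr ger0_norm// ltW// orbit_radius_gt0.
Qed.

(** Rotations preserve the norm, so the normalizing factors of the field are
    constant along the orbit and its entries are polynomials in waves. *)
Lemma Gamma_trigpoly : trigpoly_mx (Gamma o).
Proof.
have hpos : trigpoly_mx (position o).
  apply: trigpoly_mx_mul; first exact: trigpoly_mx_cst.
  apply: trigpoly_vec3; [| |exact: trigpoly_cst]; apply: trigpolyZ.
    exact: trigpoly_cos.
  exact: trigpoly_sin.
have hdir : trigpoly_mx (position_dir o).
  rewrite (_ : position_dir o = fun t => (orbit_radius o)^-1 *: position o t).
    by apply: trigpoly_mxZ => //; exact: trigpoly_cst.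
  by apply/funext => t; rewrite /position_dir enorm_position.
have hdip : trigpoly_mx (dipole_dir o).
  apply: trigpoly_vec3; [| |exact: trigpoly_cst]; apply: trigpolyZ.
    exact: trigpoly_cos.
  exact: trigpoly_sin.
have hB : trigpoly_mx (Bfield o).
  rewrite (_ : Bfield o = fun t => (mu_m o / orbit_radius o ^+ 3) *:
    ((3%:R * dot (dipole_dir o t) (position_dir o t)) *: position_dir o t
     - dipole_dir o t)); last first.
    by apply/funext => t; rewrite /Bfield enorm_position.
  apply: trigpoly_mxZ; first exact: trigpoly_cst.
  apply: trigpoly_mxB => //; apply: trigpoly_mxZ => //; apply: trigpolyZ.
  exact: trigpoly_dot.
by apply: trigpoly_mx_mul; [|apply: trigpoly_mx_tr]; exact: trigpoly_crossmx.
Qed.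

Lemma Gamma_continuous i j : continuous (fun t => Gamma o t i j).
Proof. exact: trigpoly_continuous (Gamma_trigpoly i j). Qed.

Lemma Gamma_bounded : exists2 b, 0 <= b & forall t u, enorm (Gamma o t *m u) <= b * enorm u.
Proof.
have /choice[b hb] : forall ij, exists b, forall t, `|Gamma o t ij.1 ij.2| <= b.
  by move=> [i j]; have [b _ hb] := trigpoly_bounded (Gamma_trigpoly i j); exists b.
pose B := \sum_ij `|b ij|.
have Bb i j t : `|Gamma o t i j| <= B.
  rewrite (le_trans (hb (i, j) t))// (le_trans (ler_norm _))//.
  by rewrite /B (bigD1 (i, j))//= lerDl sumr_ge0.
exists ((3 * 3)%:R * B) => [|t u]; last exact: enorm_mulmx_entries.
by rewrite mulr_ge0// sumr_ge0.
Qed.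

(** U is what makes averaging elementary here: the deviation of Gamma from its
    mean has a bounded primitive, so a correction of relative size eps in the
    Lyapunov function replaces Gamma by its mean up to higher order. *)
Lemma Gamma_deviation_primitive : exists U : K -> 'M[K]_3,
  (exists2 b, 0 <= b & forall t u, enorm (U t *m u) <= b * enorm u) /\
  forall (t : K) i j, is_derive t 1 (fun s => U s i j) ((Gamma o t - Gamma_av o) i j).
Proof.
have /choice[F hF] : forall ij : 'I_3 * 'I_3, exists F : K -> K,
    (exists b, forall t, `|F t| <= b) /\
    forall t : K, is_derive t 1 F ((Gamma o t - Gamma_av o) ij.1 ij.2).
  move=> [i j]; have [m [F [[b b0 Fb] dF]]] := trigpoly_primitive (Gamma_trigpoly i j).
  exists F; split; first by exists b.
  have avE : Gamma_av o i j = m.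
    by rewrite mxE; exact: average_of_bounded_primitive (@Gamma_continuous i j) Fb dF.
  move=> t; rewrite /= (_ : (Gamma o t - Gamma_av o) i j = Gamma o t i j - m)//.
  by rewrite -avE mxE; congr (_ + _); rewrite mxE.
have /choice[b hb] : forall ij, exists b, forall t, `|F ij t| <= b by move=> ij; case: (hF ij).
pose B := \sum_ij `|b ij|.
exists (fun t => \matrix_(i, j) F (i, j) t); split.
  exists ((3 * 3)%:R * B) => [|t u]; first by rewrite mulr_ge0// sumr_ge0.
  apply: enorm_mulmx_entries => i j; rewrite mxE.
  rewrite (le_trans (hb (i, j) t))// (le_trans (ler_norm _))//.
  by rewrite /B (bigD1 (i, j))//= lerDl sumr_ge0.
move=> t i j; have [_ /(_ t)] := hF (i, j).
rewrite (_ : F (i, j) = fun s => (\matrix_(i, j) F (i, j) s) i j)//.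
by apply/funext => s; rewrite mxE.
Qed.

End GeomagneticField.

(** * Differential inequalities *)

Section DifferentialInequalities.
Variable K : realType.
Implicit Types (f g h : K -> K) (a b c r t : K).

Lemma derive_le0_nonincreasing f a b : a <= b -> continuous f ->
  (forall x, a < x -> x < b -> exists2 df, is_derive x 1 f df & df <= 0) ->
  f b <= f a.
Proof.
move=> ab cf df; apply: (@ler0_derive1_nincr _ f a b) => //.
- by move=> x; rewrite in_itv/= => /andP[ax xb]; have [d [] ] := df x ax xb.
- move=> x; rewrite in_itv/= => /andP[ax xb]; have [d hd d0] := df x ax xb.
  by rewrite derive1E derive_val.
- exact: continuous_subspaceT.
Qed.

(** Comparing derivatives takes the place of integral estimates. *)
Lemma derive_norm_le g h a b : a <= b -> continuous g -> continuous h ->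
  (forall x, a < x -> x < b -> exists dg dh,
     [/\ is_derive x 1 g dg, is_derive x 1 h dh & `|dg| <= dh]) ->
  `|g b - g a| <= h b - h a.
Proof.
move=> ab cg ch dgh; rewrite ler_norml; apply/andP; split.
- rewrite -subr_ge0.
  suff : - g b - h b <= - g a - h a by lra.
  apply: (@derive_le0_nonincreasing (fun t => - g t - h t) a b) => //.
    by move=> x; apply: cvgB; [apply: cvgN; exact: cg|exact: ch].
  move=> x ax xb; have [dg [dh [hg hh]]] := dgh x ax xb.
  rewrite ler_norml => /andP[l1 l2]; exists (- dg - dh); last by lra.
  exact: is_deriveB.
- suff : g b - h b <= g a - h a by lra.
  apply: (@derive_le0_nonincreasing (fun t => g t - h t) a b) => //.
    by move=> x; apply: cvgB; [exact: cg|exact: ch].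
  move=> x ax xb; have [dg [dh [hg hh]]] := dgh x ax xb.
  rewrite ler_norml => /andP[l1 l2]; exists (dg - dh); last by lra.
  exact: is_deriveB.
Qed.

Lemma derive_expR_affine c a t :
  is_derive t 1 (fun s => expR (c * (s - a))) (c * expR (c * (t - a))).
Proof.
have h := derive_ptZ c (derive_ptB (derive_pt_id t) (derive_pt_cst t a)).
have hc : is_derive t 1 (fun s => expR (c * (s - a))) (expR (c * (t - a)) * (c * (1 - 0))).
  refine (is_derive1_comp _ h).
by apply: (is_derive_eq hc); rewrite subr0 mulr1 mulrC.
Qed.

(** The product of f with expR (gam * t) is nonincreasing. *)
Lemma gronwall_decay f gam a b : a <= b -> continuous f ->
  (forall x, a < x -> x < b -> exists2 df, is_derive x 1 f df & df <= - gam * f x) ->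
  f b <= f a * expR (- gam * (b - a)).
Proof.
move=> ab cf df.
have : f b * expR (gam * (b - a)) <= f a * expR (gam * (a - a)).
  apply: (@derive_le0_nonincreasing (fun t => f t * expR (gam * (t - a))) a b) => //.
    move=> x; apply: cvgM; first exact: cf.
    exact: derive_pt_continuous (derive_expR_affine gam a x).
  move=> x ax xb; have [d hd dle] := df x ax xb.
  exists (d * expR (gam * (x - a)) + f x * (gam * expR (gam * (x - a)))).
    exact: derive_ptM hd (derive_expR_affine gam a x).
  by have := expR_gt0 (gam * (x - a)); set e := expR _ => e0; nra.
rewrite subrr mulr0 expR0 mulr1 => h.
by rewrite mulNr expRN ler_pdivlMr ?expR_gt0.
Qed.

Lemma continuous_gt_nbhs f t c : {for t, continuous f} -> c < f t ->
  exists2 d, 0 < d & forall s, `|s - t| < d -> c < f s.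
Proof.
move=> cf cft.
have /cvgrPdist_lt/(_ (f t - c)) := cf; rewrite subr_gt0 => /(_ cft).
move=> /nbhs_ballP[d /= d0 hd]; exists d => // s st.
have /hd /= : ball t d s by rewrite /ball /= distrC.
by have := ler_norm (f t - f s); lra.
Qed.

(** The region e < r cannot be left, because as long as
    the trajectory stays in it the Lyapunov function decays, which confines e
    to the smaller region e <= a2 * e t0 / a1. *)
Lemma lyapunov_trap (e L : K -> K) (t0 r a1 a2 gam : K) :
  continuous e -> continuous L -> 0 < a1 -> 0 < gam ->
  (forall t, t0 <= t -> (forall s, t0 <= s -> s <= t -> e s < r) ->
     a1 * e t <= L t /\ L t <= a2 * e t /\
     (t0 < t -> exists2 dL, is_derive t 1 L dL & dL <= - gam * L t)) ->
  e t0 < r -> a2 * e t0 < a1 * r -> 0 <= a2 * e t0 ->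
  forall t, t0 <= t -> e t < r /\ a1 * e t <= a2 * e t0 * expR (- gam * (t - t0)).
Proof.
move=> ce cL a10 gam0 H e0r small nneg.
have decay t : t0 <= t -> (forall s, t0 <= s -> s <= t -> e s < r) ->
    a1 * e t <= a2 * e t0 * expR (- gam * (t - t0)).
  move=> t0t es; have [h1 _] := H t t0t es; apply: le_trans h1 _.
  apply: le_trans (gronwall_decay (gam := gam) t0t cL _) _.
    move=> x t0x xt; have [||_ [_]] := H x; [exact: ltW| |exact].
    by move=> s t0s sx; apply: es => //; rewrite (le_trans sx)// ltW.
  apply: ler_wpM2r; first exact: expR_ge0.
  have [||_ []//] := H t0; first by [].
  by move=> s s0 s1; rewrite (_ : s = t0)//; apply/eqP; rewrite eq_le s0 s1.
suff er t : t0 <= t -> e t < r.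
  by move=> t t0t; split; [exact: er|apply: decay => // s s0 _; exact: er].
move=> t0t; rewrite ltNge; apply/negP => ret.
pose S := [set s | t0 <= s /\ r <= e s].
have S0 : S !=set0 by exists t.
have lS : has_lbound S by exists t0 => s [].
pose T := inf S.
have t0T : t0 <= T by apply: lb_le_inf => // s [].
have TS s : t0 <= s -> s < T -> e s < r.
  move=> s0 sT; rewrite ltNge; apply/negP => rs.
  by have : T <= s; [apply: ge_inf|rewrite leNgt sT].
have reT : r <= e T.
  rewrite leNgt; apply/negP => eTr.
  have [||d d0 hd] := @continuous_gt_nbhs (fun s => - e s) T (- r).
  - by apply: cvgN; exact: ce.
  - by rewrite ltrN2.
  have [s [s0 rs] sT] := inf_adherent d0 (conj S0 lS).
  have Ts : T <= s by apply: ge_inf.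
  have := hd s; rewrite ltrN2 ger0_norm ?subr_ge0// ltrBlDl => /(_ sT).
  by rewrite ltNge rs.
have {}t0T : t0 < T.
  by rewrite lt_neqAle t0T andbT; apply: contraTneq reT => <-; rewrite -ltNge.
have [||d d0 hd] := @continuous_gt_nbhs e T (a2 * e t0 / a1).
- exact: ce.
- by rewrite (lt_le_trans _ reT)// ltr_pdivrMr// [ltRHS]mulrC.
pose s := Num.max t0 (T - d / 2%:R).
have s0 : t0 <= s by rewrite le_max lexx.
have sT : s < T by rewrite gt_max t0T ltrBlDr ltrDl divr_gt0.
have := hd s; rewrite ltr0_norm ?subr_lt0// opprB.
have -> : T - s < d.
  have : T - d / 2%:R <= s by rewrite le_max lexx orbT.
  by lra.
move=> /(_ isT); rewrite ltr_pdivrMr// ltNge => /negP; apply.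
rewrite mulrC; apply: le_trans (decay s s0 _) _.
  by move=> u u0 us; apply: TS => //; exact: le_lt_trans us sT.
apply: ler_piMr => //; rewrite -expR0 ler_expR.
by rewrite mulNr oppr_le0 mulr_ge0// ?(ltW gam0)// subr_ge0.
Qed.

End DifferentialInequalities.

(** * Global solutions of Lipschitz differential equations *)

Section ContinuousCurves.
Variable K : realType.

Definition continuous_coords n (x : K -> 'cV[K]_n) :=
  forall i, continuous (fun t => x t i 0).

Lemma continuous_clamp (t0 : K) : continuous (fun t => Num.max t t0).
Proof.
by move=> t; apply: (@continuous_max _ _ id (fun=> t0)); [exact: cvg_id|exact: cvg_cst].
Qed.

Lemma within_continuous_clamp n (x : K -> 'cV[K]_n) t0 :
  {within `[t0, +oo[, continuous x} -> continuous_coords (fun t => x (Num.max t t0)).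
Proof.
move=> /subspace_continuousP cx i t.
have mt : `[t0, +oo[%classic (Num.max t t0) by rewrite /= in_itv/= andbT le_max lexx orbT.
have cm : (fun s => Num.max s t0) @ t --> within `[t0, +oo[ (nbhs (Num.max t t0)).
  move=> A /= wA; have := @continuous_clamp t0 t _ wA.
  apply: (@filterS _ (nbhs t)) => s /=; apply.
  by rewrite in_itv/= andbT le_max lexx orbT.
have cx' := cvg_comp _ _ cm (cx _ mt).
exact: (cvg_comp _ _ cx' (@coord_continuous _ _ _ i 0 (x (Num.max t t0)))).
Qed.

Lemma continuous_of_coords n (x : K -> 'cV[K]_n) : continuous_coords x -> continuous x.
Proof.
move=> cx t; apply/cvgrPdist_le => e e0; near=> s.
rewrite [leLHS]/Num.Def.normr/= mx_normrE (bigmax_le _ (ltW e0))//= => ij _.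
rewrite !mxE/=; move: ij; near: s; apply: filter_forall => -[i j] /=.
by rewrite (ord1 j); apply: ((cvgrPdist_le _ _).1 (cx i t)).
Unshelve. all: by end_near. Qed.

Lemma is_derive_of_coords n (x : K -> 'cV[K]_n) (t : K) (v : 'cV[K]_n) :
  (forall i, is_derive t 1 (fun s => x s i 0) (v i 0)) ->
  derivable x t 1 /\ 'D_1 x t = v.
Proof.
move=> dx; have dx' : derivable x t 1.
  by apply/derivable_mxP => i j; rewrite (ord1 j); case: (dx i).
split=> //; rewrite derive_mx//; apply/matrixP => i j.
by rewrite mxE (ord1 j); case: (dx i).
Qed.

Lemma is_derive_coords n (x : K -> 'cV[K]_n) (t : K) : derivable x t 1 ->
  forall i, is_derive t 1 (fun s => x s i 0) (('D_1 x t) i 0).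
Proof.
move=> dx i; rewrite derive_mx// mxE; apply: derivableP.
exact: ((derivable_mxP _ _ _).1 dx).
Qed.

End ContinuousCurves.

Section Picard.
Variable K : realType.

Lemma continuous_primitive (g : K -> K) t0 : continuous g ->
  exists2 G : K -> K, G t0 = 0 & forall t : K, t0 <= t -> is_derive t 1 G (g t).
Proof.
move=> cg; pose F x := \int[lebesgue_measure]_(s in `[t0 - 1, x]) g s.
exists (fun t => F t - F t0) => [|t t0t]; first exact: subrr.
have [||||dF F'] := @continuous_FTC1_closed _ g (t0 - 1) t (t + 1).
- by rewrite ltrDl.
- apply: continuous_compact_integrable; first exact: segment_compact.
  exact: continuous_subspaceT.
- by rewrite ltrBlDr (le_lt_trans t0t)// ltrDl.
- exact: cg.
have {}dF : is_derive t 1 F (g t) by apply: (DeriveDef dF); rewrite -derive1E; exact: F'.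
by apply: (is_derive_eq (derive_ptB dF (derive_pt_cst t (F t0)))); rewrite subr0.
Qed.

Lemma le_of_geometric_gap (a b c : K) : 0 <= c ->
  (forall k, a <= b + c * 2%:R ^- k) -> a <= b.
Proof.
move=> c0 H; rewrite leNgt; apply/negP => ba.
have ab0 : 0 < a - b by rewrite subr_gt0.
have [k ck] : exists k, c / (a - b) < 2%:R ^+ k.
  exists (Num.bound (c / (a - b))).
  apply: (lt_le_trans (archi_boundP _)); first by rewrite divr_ge0// ltW.
  by rewrite -natrX ler_nat ltnW// ltn_expl.
have := H k; rewrite -lerBlDl leNgt => /negP; apply.
by rewrite ltr_pdivrMr ?exprn_gt0// mulrC -ltr_pdivrMr.
Qed.

Variables (n : nat) (f : K -> 'cV[K]_n -> 'cV[K]_n) (lip M t0 : K) (x0 : 'cV[K]_n).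
Hypothesis lip_ge0 : 0 <= lip.
Hypothesis f_bounded : forall t x i, `|f t x i 0| <= M.
Hypothesis f_lipschitz : forall t (x y : 'cV[K]_n) d,
  (forall j, `|x j 0 - y j 0| <= d) -> forall i, `|f t x i 0 - f t y i 0| <= lip * d.
Hypothesis f_continuous : forall x, continuous_coords x ->
  continuous_coords (fun t => f t (x t)).

Let picard_step : exists T : (K -> 'cV[K]_n) -> (K -> 'cV[K]_n),
  forall x, continuous_coords x -> [/\ T x t0 = x0, continuous_coords (T x) &
    forall t : K, t0 < t -> forall i, is_derive t 1 (fun s => T x s i 0) (f t (x t) i 0)].
Proof.
suff /choice[T hT] : forall x : K -> 'cV[K]_n, exists y : K -> 'cV[K]_n,
    continuous_coords x -> [/\ y t0 = x0, continuous_coords y &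
    forall t : K, t0 < t -> forall i, is_derive t 1 (fun s => y s i 0) (f t (x t) i 0)].
  by exists T.
move=> x; have [cx|ncx] := pselect (continuous_coords x); last by exists x.
have /choice[G hG] i : exists G : K -> K, G t0 = 0 /\
    forall t : K, t0 <= t -> is_derive t 1 G (f t (x t) i 0).
  by have [G G0 dG] := continuous_primitive t0 (@f_continuous _ cx i); exists G.
exists (fun t => \col_i (x0 i 0 + G i (Num.max t t0))) => _; split.
- by apply/matrixP => i j; rewrite mxE maxxx (hG i).1 addr0 (ord1 j).
- move=> i; rewrite (_ : (fun t => _) = fun t => x0 i 0 + G i (Num.max t t0)); last first.
    by apply/funext => s; rewrite mxE.
  move=> t; apply: cvgD; first exact: cvg_cst.
  apply: continuous_comp; first exact: continuous_clamp.
  apply: derive_pt_continuous ((hG i).2 _ _).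
  by rewrite le_max lexx orbT.
- move=> t t0t i.
  apply: (@near_eq_is_derive _ _ _ (fun s => x0 i 0 + G i s)); last first.
    apply: (is_derive_eq (derive_ptD (derive_pt_cst t _) ((hG i).2 _ (ltW t0t)))).
    by rewrite add0r.
  near=> s; rewrite mxE max_l//; apply: ltW; near: s; exact: lt_nbhsr.
Unshelve. all: by end_near. Qed.

(** The Picard iterates contract in a norm with exponential weight.  Their
    common Lipschitz constant M passes to the limit and makes it continuous;
    the limit can then be fed to one more step of the iteration, which returns
    it unchanged for t >= t0. *)
Theorem picard_global : exists x : K -> 'cV[K]_n, [/\ x t0 = x0, continuous_coords x &
  forall t : K, t0 < t -> forall i, is_derive t 1 (fun s => x s i 0) (f t (x t) i 0)].
Proof.
have [T hT] := picard_step.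
pose X k := iter k T (fun=> x0).
have cX k : continuous_coords (X k).
  by elim: k => [|k IH] i; [move=> t; exact: cvg_cst|have [_ + _] := hT _ IH; exact].
have X0 k : X k t0 = x0 by case: k => [//|k]; have [] := hT _ (cX k).
have dX k (t : K) : t0 < t -> forall i,
    is_derive t 1 (fun s => X k.+1 s i 0) (f t (X k t) i 0).
  by have [_ _] := hT _ (cX k); exact.
have [M0|] := leP 0 M; last first.
  move=> Mlt0; exists (X 0); split => // t t0t i.
  by have := le_lt_trans (f_bounded t (X 0 t) i) Mlt0; rewrite normr_lt0.
pose l := lip + 1.
have l0 : 0 < l by rewrite ltr_wpDl.
pose e t := M * expR (2%:R * l * (t - t0)).
have de (t : K) : is_derive t 1 e (2%:R * l * e t).
  apply: (is_derive_eq (derive_ptZ M (derive_expR_affine (2%:R * l) t0 t))).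
  by rewrite /e mulrCA.
have ce : continuous e by move=> t; exact: derive_pt_continuous (de t).
have e0 t : 0 <= e t by rewrite mulr_ge0// expR_ge0.
have cZ a : continuous (fun t => a * e t) by move=> t; apply: cvgZr; exact: ce.
(* 2 * l in the exponent makes the iteration a contraction of ratio 1/2 for the
   norm weighted by e *)
have step k t i : t0 <= t -> `|X k.+1 t i 0 - X k t i 0| <= 2%:R ^- k * e t.
  elim: k t i => [|k IH] t i t0t.
    have : `|X 1 t i 0 - X 1 t0 i 0| <= e t - e t0.
      apply: (@derive_norm_le _ (fun s => X 1%N s i 0) e) => //; first exact: cX.
      move=> s t0s st; exists (f s (X 0 s) i 0), (2%:R * l * e s); split => //; first exact: dX.
      apply: (le_trans (f_bounded _ _ _)).
      have M1 : M <= e s.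
        rewrite /e ler_peMr// -expR0 ler_expR mulr_ge0// ?mulr_ge0 ?(ltW l0)//.
        by rewrite subr_ge0 ltW.
      have : 0 <= lip * e s by rewrite mulr_ge0.
      by have := e0 s; rewrite /l; lra.
    rewrite X0 expr0 invr1 mul1r /=; have := e0 t0; lra.
  have : `|(X k.+2 t i 0 - X k.+1 t i 0) - (X k.+2 t0 i 0 - X k.+1 t0 i 0)|
         <= 2%:R ^- k.+1 * e t - 2%:R ^- k.+1 * e t0.
    apply: (@derive_norm_le _ (fun s => X k.+2 s i 0 - X k.+1 s i 0)
              (fun s => 2%:R ^- k.+1 * e s)) => //.
      by move=> s; apply: cvgB; exact: cX.
    move=> s t0s st.
    exists (f s (X k.+1 s) i 0 - f s (X k s) i 0), (2%:R ^- k.+1 * (2%:R * l * e s)).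
    split; [exact: derive_ptB (dX _ _ t0s i) (dX _ _ t0s i)|exact: derive_ptZ|].
    have := f_lipschitz s (fun j => IH s j (ltW t0s)) i.
    move=> /le_trans; apply.
    have p0 : 0 <= (2%:R : K) ^- k by rewrite invr_ge0 exprn_ge0.
    have pe : 0 <= 2%:R ^- k * e s by rewrite mulr_ge0.
    have -> : 2%:R ^- k.+1 * (2%:R * l * e s) = l * (2%:R ^- k * e s).
      by rewrite exprS invfM; field; rewrite expf_neq0.
    by apply: ler_wpM2r => //; rewrite /l lerDl.
  rewrite !X0 !subrr subr0 => /le_trans; apply.
  by rewrite gerBl mulr_ge0// invr_ge0 exprn_ge0.
(* nested intervals of half-length 2 * 2^-k * e t around the iterates *)
have /choice[x hx] : forall t, exists xt : 'cV[K]_n, t0 <= t ->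
    forall k i, `|X k t i 0 - xt i 0| <= 2%:R * 2%:R ^- k * e t.
  move=> t; have [t0t|] := leP t0 t; last by exists 0.
  pose lo i k := X k t i 0 - 2%:R * 2%:R ^- k * e t.
  pose hi i k := X k t i 0 + 2%:R * 2%:R ^- k * e t.
  have half k : 2%:R * 2%:R ^- k.+1 * e t = 2%:R ^- k * e t.
    by rewrite exprS invfM; field; rewrite expf_neq0.
  have lo_nd i k m : lo i k <= lo i (m + k)%N.
    elim: m => [//|m IH]; apply: le_trans IH _; rewrite addSn /lo half.
    by have := step (m + k)%N t i t0t; rewrite ler_norml => /andP[]; lra.
  have hi_ni i k m : hi i (m + k)%N <= hi i k.
    elim: m => [//|m IH]; apply: le_trans IH; rewrite addSn /hi half.
    by have := step (m + k)%N t i t0t; rewrite ler_norml => /andP[]; lra.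
  have lohi i k m : lo i k <= hi i m.
    apply: (le_trans (lo_nd i k m)); apply: (le_trans _ (hi_ni i m k)).
    rewrite addnC /lo /hi lerD2l.
    have : 0 <= 2%:R * 2%:R ^- (k + m) * e t by rewrite !mulr_ge0// invr_ge0 exprn_ge0.
    by lra.
  exists (\col_i sup (range (lo i))) => _ k i; rewrite mxE.
  have h1 : lo i k <= sup (range (lo i)).
    by apply: ub_le_sup; [exists (hi i 0%N) => _ [j _ <-]|exists k].
  have h2 : sup (range (lo i)) <= hi i k.
    by apply: ge_sup; [exists (lo i 0%N); exists 0%N|move=> _ [j _ <-]].
  by rewrite ler_norml; apply/andP; move: h1 h2; rewrite /lo /hi; split; lra.
have X_lip k s t i : t0 <= s -> s <= t -> `|X k t i 0 - X k s i 0| <= M * t - M * s.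
  move=> t0s st; case: k => [|k]; first by rewrite subrr normr0 -mulrBr mulr_ge0// subr_ge0.
  apply: (@derive_norm_le _ (fun t => X k.+1 t i 0) (fun t => M * t)) => //.
  - exact: cX.
  - by move=> u; apply: cvgZr; exact: cvg_id.
  - move=> u su _; exists (f u (X k u) i 0), (M * 1); split.
    + by apply: dX; exact: le_lt_trans su.
    + exact: derive_ptZ (derive_pt_id u).
    + by rewrite mulr1.
have x_lip s t i : t0 <= s -> s <= t -> `|x t i 0 - x s i 0| <= M * t - M * s.
  move=> t0s st; have t0t := le_trans t0s st.
  apply: (@le_of_geometric_gap _ _ (2%:R * e t + 2%:R * e s)).
    by rewrite addr_ge0// mulr_ge0.
  move=> k; have := X_lip k s t i t0s st.
  have := hx s t0s k i; have := hx t t0t k i; rewrite !ler_norml.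
  by move=> /andP[? ?] /andP[? ?] /andP[? ?]; apply/andP; split; lra.
pose y t := x (Num.max t t0).
have cy : continuous_coords y.
  move=> i t; apply/cvgrPdist_le => d d0; near=> s.
  have lip_y u v : u <= v -> `|y v i 0 - y u i 0| <= M * (v - u).
    move=> uv; have uv' : Num.max u t0 <= Num.max v t0 by rewrite le_max2.
    apply: (le_trans (x_lip _ _ i _ uv')); first by rewrite le_max lexx orbT.
    rewrite -mulrBr; apply: ler_wpM2l => //.
    by rewrite /Num.max; case: ltP => ?; case: ltP => ?; lra.
  have yst : `|y t i 0 - y s i 0| <= M * `|t - s|.
    have [st|ts] := leP s t; first by rewrite [`|t - s|]ger0_norm ?subr_ge0// lip_y.
    by rewrite distrC [`|t - s|]distrC [`|s - t|]ger0_norm ?subr_ge0 ?lip_y// ltW.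
  apply: (le_trans yst).
  apply: (@le_trans _ _ ((M + 1) * `|t - s|)).
    by apply: ler_wpM2r => //; rewrite lerDl.
  rewrite mulrC -ler_pdivlMr ?ltr_wpDl//.
  by near: s; apply: cvgr_dist_le; [exact: cvg_id|rewrite divr_gt0// ltr_wpDl].
have [Ty0 cTy dTy] := hT _ cy.
have Ty_x t i : t0 <= t -> T y t i 0 = y t i 0.
  move=> t0t; rewrite /y max_l//.
  suff near_x : `|T y t i 0 - x t i 0| <= 0.
    by apply/eqP; rewrite -subr_eq0 -normr_le0.
  apply: (@le_of_geometric_gap _ _ (3%:R * e t)); first by rewrite mulr_ge0.
  move=> k; rewrite add0r.
  have : `|(T y t i 0 - X k.+1 t i 0) - (T y t0 i 0 - X k.+1 t0 i 0)|
      <= 2%:R ^- k * e t - 2%:R ^- k * e t0.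
    apply: (@derive_norm_le _ (fun s => T y s i 0 - X k.+1 s i 0) (fun s => 2%:R ^- k * e s)) => //.
      by move=> s; apply: cvgB; [exact: cTy|exact: cX].
    move=> s t0s st; exists (f s (y s) i 0 - f s (X k s) i 0), (2%:R ^- k * (2%:R * l * e s)).
    split; [exact: derive_ptB (dTy _ t0s i) (dX _ _ t0s i)|exact: derive_ptZ|].
    have yX j : `|y s j 0 - X k s j 0| <= 2%:R * 2%:R ^- k * e s.
      have -> : y s = x s by rewrite /y max_l// ltW.
      by rewrite distrC; exact: (hx s (ltW t0s) k j).
    apply: (le_trans (f_lipschitz s yX i)).
    have pe : 0 <= 2%:R ^- k * e s by rewrite mulr_ge0// invr_ge0 exprn_ge0.
    rewrite /l; lra.
  rewrite Ty0 X0 subrr subr0 => h1.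
  have h2 := hx t t0t k.+1 i.
  have h3 : 2%:R * 2%:R ^- k.+1 * e t = 2%:R ^- k * e t.
    by rewrite exprS invfM; field; rewrite expf_neq0.
  have pe s : 0 <= 2%:R ^- k * e s by rewrite mulr_ge0// invr_ge0 exprn_ge0.
  move: h1 h2; rewrite h3 !ler_norml => /andP[? ?] /andP[? ?]; apply/andP.
  by have := pe t; have := pe t0; split; lra.
exists (T y); split=> // t t0t i.
have -> : T y t = y t by apply/matrixP => j j'; rewrite (ord1 j') Ty_x// ltW.
exact: dTy.
Unshelve. all: by end_near. Qed.

End Picard.

(** * Saturated vector fields *)

Section RegularFields.
Variables (K : realType) (N : nat).
Implicit Types (g h : K -> 'cV[K]_N -> K) (t c : K) (x y : 'cV[K]_N).

(** The hypotheses that the global existence theorem puts on each coordinate of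
    a vector field; they are stable under sums and products, so that they
    propagate from the coordinates of a saturated state to any polynomial
    expression in them. *)
Definition regular g : Prop :=
  [/\ exists B, forall t x, `|g t x| <= B,
      exists2 l, 0 <= l & forall t x y d,
        (forall j, `|x j 0 - y j 0| <= d) -> `|g t x - g t y| <= l * d &
      forall x : K -> 'cV[K]_N, continuous_coords x -> continuous (fun t => g t (x t))].

Lemma regular_ext g h : (forall t x, g t x = h t x) -> regular g -> regular h.
Proof. by move=> gh; rewrite (_ : h = g)//; apply/funext => t; apply/funext => x. Qed.

Lemma regular_time (f : K -> K) b :
  (forall t, `|f t| <= b) -> continuous f -> regular (fun t _ => f t).
Proof.
move=> fb cf; split; [by exists b| |by []].
by exists 0 => // t x y d _; rewrite subrr normr0 mul0r.
Qed.

Lemma regular_cst c : regular (fun _ _ => c).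
Proof. by apply: (@regular_time (fun=> c) `|c|) => // t; exact: cvg_cst. Qed.

Lemma regularD g h : regular g -> regular h -> regular (fun t x => g t x + h t x).
Proof.
move=> [[B gB] [l l0 gl] cg] [[C hC] [m m0 hm] ch]; split.
- by exists (B + C) => t x; apply: (le_trans (ler_normD _ _)); exact: lerD.
- exists (l + m) => [|t x y d xy]; first exact: addr_ge0.
  rewrite opprD addrACA mulrDl (le_trans (ler_normD _ _))// lerD//.
    exact: gl.
  exact: hm.
- by move=> x cx t; apply: cvgD; [exact: cg|exact: ch].
Qed.

Lemma regularM g h : regular g -> regular h -> regular (fun t x => g t x * h t x).
Proof.
move=> [[B gB] [l l0 gl] cg] [[C hC] [m m0 hm] ch].
have B0 t x : 0 <= B by exact: le_trans (gB t x).
have C0 t x : 0 <= C by exact: le_trans (hC t x).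
split.
- by exists (B * C) => t x; rewrite normrM ler_pM.
- exists (`|B| * m + l * `|C|) => [|t x y d xy].
    by rewrite addr_ge0// mulr_ge0.
  have -> : g t x * h t x - g t y * h t y =
    g t x * (h t x - h t y) + (g t x - g t y) * h t y by ring.
  have -> : (`|B| * m + l * `|C|) * d = `|B| * (m * d) + l * d * `|C| by ring.
  rewrite (le_trans (ler_normD _ _))// !normrM lerD//; apply: ler_pM => //.
  - exact: le_trans (gB t x) (ler_norm _).
  - exact: hm.
  - exact: gl.
  - exact: le_trans (hC t y) (ler_norm _).
- by move=> x cx t; apply: cvgM; [exact: cg|exact: ch].
Qed.

Lemma regular_sum n (F : 'I_n -> K -> 'cV[K]_N -> K) :
  (forall i, regular (F i)) -> regular (fun t x => \sum_i F i t x).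
Proof.
elim: n F => [|n IH] F hF.
  by apply: regular_ext (regular_cst 0) => t x; rewrite big_ord0.
apply: regular_ext (regularD (hF ord0) (IH (fun i => F (lift ord0 i)) _)) => // t x.
by rewrite big_ord_recl.
Qed.

Definition regular_mx m n (M : K -> 'cV[K]_N -> 'M[K]_(m, n)) :=
  forall i j, regular (fun t x => M t x i j).

Lemma regular_mx_cst m n (M : 'M[K]_(m, n)) : regular_mx (fun _ _ => M).
Proof. by move=> i j; exact: regular_cst. Qed.

Lemma regular_mxM m n p (A : K -> 'cV[K]_N -> 'M[K]_(m, n)) (B : K -> 'cV[K]_N -> 'M[K]_(n, p)) :
  regular_mx A -> regular_mx B -> regular_mx (fun t x => A t x *m B t x).
Proof.
move=> hA hB i j.
by apply: regular_ext (regular_sum (fun k => regularM (hA i k) (hB k j))) => t x; rewrite mxE.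
Qed.

Lemma regular_mxD m n (A B : K -> 'cV[K]_N -> 'M[K]_(m, n)) :
  regular_mx A -> regular_mx B -> regular_mx (fun t x => A t x + B t x).
Proof.
by move=> hA hB i j; apply: regular_ext (regularD (hA i j) (hB i j)) => t x; rewrite mxE.
Qed.

Lemma regular_mxZ m n g (A : K -> 'cV[K]_N -> 'M[K]_(m, n)) :
  regular g -> regular_mx A -> regular_mx (fun t x => g t x *: A t x).
Proof. by move=> hg hA i j; apply: regular_ext (regularM hg (hA i j)) => t x; rewrite mxE. Qed.

Lemma regular_mxN m n (A : K -> 'cV[K]_N -> 'M[K]_(m, n)) :
  regular_mx A -> regular_mx (fun t x => - A t x).
Proof.
move=> hA i j.
by apply: regular_ext (regularM (regular_cst (-1)) (hA i j)) => t x; rewrite mxE mulN1r.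
Qed.

Lemma regular_mx_tr m n (A : K -> 'cV[K]_N -> 'M[K]_(m, n)) :
  regular_mx A -> regular_mx (fun t x => (A t x)^T).
Proof. by move=> hA i j; apply: regular_ext (hA j i) => t x; rewrite mxE. Qed.

Lemma regular_usubmx m n p (A : K -> 'cV[K]_N -> 'M[K]_(m + n, p)) :
  regular_mx A -> regular_mx (fun t x => usubmx (A t x)).
Proof. by move=> hA i j; apply: regular_ext (hA (lshift n i) j) => t x; rewrite mxE. Qed.

Lemma regular_dsubmx m n p (A : K -> 'cV[K]_N -> 'M[K]_(m + n, p)) :
  regular_mx A -> regular_mx (fun t x => dsubmx (A t x)).
Proof. by move=> hA i j; apply: regular_ext (hA (rshift m i) j) => t x; rewrite mxE. Qed.

Lemma regular_col_mx m n p (A : K -> 'cV[K]_N -> 'M[K]_(m, p))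
    (B : K -> 'cV[K]_N -> 'M[K]_(n, p)) :
  regular_mx A -> regular_mx B -> regular_mx (fun t x => col_mx (A t x) (B t x)).
Proof.
move=> hA hB i j; rewrite -(splitK i); case: (fintype.split i) => k.
  by apply: regular_ext (hA k j) => t x; rewrite col_mxEu.
by apply: regular_ext (hB k j) => t x; rewrite col_mxEd.
Qed.

Lemma regular_scalar_mx n g : regular g -> regular_mx (fun t x => (g t x)%:M : 'M[K]_n).
Proof.
move=> hg i j; apply: regular_ext (regularM hg (regular_cst (i == j)%:R)) => t x.
by rewrite mxE mulr_natr.
Qed.

Lemma regular_dot n (u v : K -> 'cV[K]_N -> 'cV[K]_n) :
  regular_mx u -> regular_mx v -> regular (fun t x => dot (u t x) (v t x)).
Proof. by move=> hu hv; exact: (regular_mxM (regular_mx_tr hu) hv). Qed.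

Lemma regular_crossmx (a : K -> 'cV[K]_N -> 'cV[K]_3) :
  regular_mx a -> regular_mx (fun t x => crossmx (a t x)).
Proof.
move=> ha; have hN := regular_mxN ha.
move=> [[|[|[|//]]] p] [[|[|[|//]]] q].
all: by [apply: regular_ext (regular_cst 0) => t x; rewrite mxE
  | apply: regular_ext (ha 0 0) => t x; rewrite mxE
  | apply: regular_ext (ha 1 0) => t x; rewrite mxE
  | apply: regular_ext (ha 2%:R 0) => t x; rewrite mxE
  | apply: regular_ext (hN 0 0) => t x; rewrite !mxE
  | apply: regular_ext (hN 1 0) => t x; rewrite !mxE
  | apply: regular_ext (hN 2%:R 0) => t x; rewrite !mxE ].
Qed.

Definition saturate c x : 'cV[K]_N := \col_i Num.max (- c) (Num.min (x i 0) c).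

Lemma saturate_id c x : (forall i, `|x i 0| <= c) -> saturate c x = x.
Proof.
move=> xc; apply/matrixP => i j; rewrite mxE (ord1 j).
by have := xc i; rewrite ler_norml => /andP[h1 h2]; rewrite min_l// max_r.
Qed.

Lemma regular_saturate c : 0 <= c -> regular_mx (fun _ x => saturate c x).
Proof.
move=> c0 i j; split.
- exists c => t x; rewrite mxE ler_norml le_max lexx/= ge_max ge_min lexx orbT andbT.
  by rewrite (le_trans _ c0)// oppr_le0.
- exists 1 => // t x y d /(_ i); rewrite mul1r !mxE; apply: le_trans.
  set a := x i 0; set b := y i 0.
  have ab : a - b <= `|a - b| by exact: ler_norm.
  have ba : b - a <= `|a - b| by rewrite distrC; exact: ler_norm.
  rewrite ler_norml; set n := `|a - b| in ab ba *; clearbody n.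
  by rewrite /Num.max /Num.min; case: (ltP a c) => ?; case: (ltP b c) => ?;
    do 2 case: ltP => ?; apply/andP; split; lra.
- move=> x cx; rewrite (_ : (fun t => _) = fun t => Num.max (- c) (Num.min (x t i 0) c)).
    move=> t; apply: (@continuous_max _ _ (fun=> - c) (fun t => Num.min (x t i 0) c)).
      exact: cvg_cst.
    apply: (@continuous_min _ _ (fun t => x t i 0) (fun=> c)); first exact: cx.
    exact: cvg_cst.
  by apply/funext => t; rewrite mxE.
Qed.

(** A field that is regular on a box need not have global solutions, but its
    saturation does, and the two agree as long as the solution stays in the box. *)
Lemma exists_saturated_solution (f : K -> 'cV[K]_N -> 'cV[K]_N) c t0 x0 :
  regular_mx (fun t x => f t (saturate c x)) ->
  exists x : K -> 'cV[K]_N, [/\ x t0 = x0, continuous_coords x &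
    forall t : K, t0 < t -> forall i,
      is_derive t 1 (fun s => x s i 0) (f t (saturate c (x t)) i 0)].
Proof.
move=> hf.
have /choice[B hB] : forall i, exists B, forall t x, `|f t (saturate c x) i 0| <= B.
  by move=> i; have [] := hf i 0.
have /choice[l hl] : forall i, exists l, 0 <= l /\ forall t (x y : 'cV[K]_N) d,
    (forall j, `|x j 0 - y j 0| <= d) ->
    `|f t (saturate c x) i 0 - f t (saturate c y) i 0| <= l * d.
  by move=> i; have [_ [l l0 hl] _] := hf i 0; exists l.
apply: (@picard_global _ _ (fun t x => f t (saturate c x)) (\sum_i l i) (\sum_i `|B i|)).
- by apply: sumr_ge0 => i _; have [] := hl i.
- move=> t x i; apply: (le_trans (hB i t x)); apply: (le_trans (ler_norm _)).
  by rewrite (bigD1 i)//= lerDl sumr_ge0.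
- move=> t x y d xy i; apply: (le_trans ((hl i).2 t x y d xy)).
  have d0 : 0 <= d by exact: le_trans (xy i).
  apply: ler_wpM2r => //; rewrite (bigD1 i)//= lerDl.
  by apply: sumr_ge0 => j _; have [] := hl j.
- by move=> x cx i; have [_ _] := hf i 0; exact.
Qed.

End RegularFields.

Section ClosedLoopField.
Variables (K : realType) (G : K -> 'M[K]_3) (J : 'M[K]_3) (k1 k2 alpha lambda eps : K).

(** The implicit equations of the closed loop, solved for the velocity. *)
Definition closed_loop_field (t : K) (x : 'cV[K]_(4 + 3 + 4)) : 'cV[K]_(4 + 3 + 4) :=
  let q := state_q x in let w := state_w x in let d := state_d x in
  state (Wmx q *m w)
    (invmx J *m (- (crossmx w *m (J *m w)) +
       Amx q *m G t *m (Amx q)^T *m control k1 k2 alpha lambda eps q d))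
    (alpha *: (q - (eps * lambda) *: d)).

Lemma state_qE (q : 'cV[K]_4) (w : 'cV[K]_3) (d : 'cV[K]_4) : state_q (state q w d) = q.
Proof. by rewrite /state_q /state !col_mxKu. Qed.

Lemma state_wE (q : 'cV[K]_4) (w : 'cV[K]_3) (d : 'cV[K]_4) : state_w (state q w d) = w.
Proof. by rewrite /state_w /state col_mxKu col_mxKd. Qed.

Lemma state_dE (q : 'cV[K]_4) (w : 'cV[K]_3) (d : 'cV[K]_4) : state_d (state q w d) = d.
Proof. by rewrite /state_d /state col_mxKd. Qed.

Lemma closed_loop_fieldP t x : J \in unitmx ->
  closed_loop G J k1 k2 alpha lambda eps t x (closed_loop_field t x).
Proof.
by move=> uJ; split; rewrite /closed_loop_field ?state_qE ?state_wE ?state_dE// mulKVmx.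
Qed.

Lemma closed_loop_field_regular c : 0 <= c ->
  (forall i j, continuous (fun t => G t i j)) ->
  (forall i j, exists b, forall t, `|G t i j| <= b) ->
  regular_mx (fun t x => closed_loop_field t (saturate c x)).
Proof.
move=> c0 cG bG.
have hx := @regular_saturate K (4 + 3 + 4) c c0.
have hq : regular_mx (fun (_ : K) x => state_q (saturate c x)).
  exact: regular_usubmx (regular_usubmx hx).
have hw : regular_mx (fun (_ : K) x => state_w (saturate c x)).
  exact: regular_dsubmx (regular_usubmx hx).
have hd : regular_mx (fun (_ : K) x => state_d (saturate c x)).
  exact: regular_dsubmx hx.
have hv : regular_mx (fun (_ : K) x => vpart (state_q (saturate c x))).
  exact: (@regular_usubmx _ _ 3 1 _ _ hq).
have hs : regular (fun (_ : K) x => spart (state_q (saturate c x))).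
  exact: (@regular_dsubmx _ _ 3 1 _ _ hq).
have hG : regular_mx (fun t (_ : 'cV[K]_(4 + 3 + 4)) => G t).
  by move=> i j; have [b hb] := bG i j; exact: (@regular_time _ _ (fun t => G t i j) b).
have hW : regular_mx (fun (_ : K) x => Wmx (state_q (saturate c x))).
  apply: regular_mxZ; first exact: regular_cst.
  apply: (@regular_col_mx _ _ 3 1 3).
    apply: regular_mxD; first exact: regular_scalar_mx.
    exact: regular_crossmx.
  by apply: regular_mxN; exact: regular_mx_tr.
have hA : regular_mx (fun (_ : K) x => Amx (state_q (saturate c x))).
  apply: regular_mxD; last first.
    apply: regular_mxN; apply: regular_mxZ; last exact: regular_crossmx.
    by apply: regularM => //; exact: regular_cst.
  apply: regular_mxD; last first.
    apply: regular_mxZ; first exact: regular_cst.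
    by apply: regular_mxM => //; exact: regular_mx_tr.
  apply: regular_scalar_mx; apply: regularD; first exact: (regularM hs hs).
  apply: regular_ext (regularM (regular_cst _ (-1)) (regular_dot hv hv)) => t x.
  by rewrite mulN1r.
have hp : regular_mx (fun (_ : K) x =>
    state_q (saturate c x) - (eps * lambda) *: state_d (saturate c x)).
  apply: regular_mxD => //; apply: regular_mxN; apply: regular_mxZ => //.
  exact: regular_cst.
apply: regular_col_mx; last by apply: regular_mxZ => //; exact: regular_cst.
apply: regular_col_mx; first exact: regular_mxM.
apply: regular_mxM; first exact: regular_mx_cst.
apply: regular_mxD.
  apply: regular_mxN; apply: regular_mxM; first exact: regular_crossmx.
  by apply: regular_mxM => //; exact: regular_mx_cst.
apply: regular_mxM.
  by apply: regular_mxM; [apply: regular_mxM|exact: regular_mx_tr].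
apply: regular_mxN; apply: regular_mxZ; first exact: regular_cst.
apply: regular_mxD; first by apply: regular_mxZ => //; exact: regular_cst.
apply: regular_mxZ; first exact: regular_cst.
by apply: regular_mxM => //; exact: regular_mx_tr.
Qed.

End ClosedLoopField.

(** * The Lyapunov function of the averaged closed loop *)

Section ContinuousCurveOperations.
Variable K : realType.

Lemma continuous_sum n (F : 'I_n -> K -> K) :
  (forall i, continuous (F i)) -> continuous (fun t => \sum_i F i t).
Proof.
elim: n F => [|n IH] F cF.
  by under eq_fun do rewrite big_ord0; move=> t; exact: cvg_cst.
under eq_fun do rewrite big_ord_recl.
by move=> t; apply: cvgD; [exact: cF|exact: (IH (fun i => F (lift ord0 i)))].
Qed.

Lemma continuous_coords_mulmx n m (A : K -> 'M[K]_(m, n)) (x : K -> 'cV[K]_n) :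
  (forall i j, continuous (fun s => A s i j)) -> continuous_coords x ->
  continuous_coords (fun s => A s *m x s).
Proof.
move=> cA cx i; rewrite (_ : (fun s => _) = fun s => \sum_j A s i j * x s j 0).
  by apply: continuous_sum => j s; apply: cvgM; [exact: cA|exact: cx].
by apply/funext => r; rewrite mxE.
Qed.

Lemma continuous_coords_mulmxl n m (A : 'M[K]_(m, n)) (x : K -> 'cV[K]_n) :
  continuous_coords x -> continuous_coords (fun s => A *m x s).
Proof. by apply: continuous_coords_mulmx => i j s; exact: cvg_cst. Qed.

Lemma continuous_coordsD n (x y : K -> 'cV[K]_n) :
  continuous_coords x -> continuous_coords y -> continuous_coords (fun s => x s + y s).
Proof.
move=> cx cy i; rewrite (_ : (fun s => _) = fun s => x s i 0 + y s i 0).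
  by move=> s; apply: cvgD; [exact: cx|exact: cy].
by apply/funext => r; rewrite mxE.
Qed.

Lemma continuous_coordsZ n a (x : K -> 'cV[K]_n) :
  continuous_coords x -> continuous_coords (fun s => a *: x s).
Proof.
move=> cx i; rewrite (_ : (fun s => _) = fun s => a * x s i 0).
  by move=> s; apply: cvgZr; exact: cx.
by apply/funext => r; rewrite mxE.
Qed.

Lemma continuous_coordsB n (x y : K -> 'cV[K]_n) :
  continuous_coords x -> continuous_coords y -> continuous_coords (fun s => x s - y s).
Proof.
move=> cx cy; rewrite (_ : (fun s => _) = fun s => x s + (-1) *: y s).
  by apply: continuous_coordsD => //; exact: continuous_coordsZ.
by apply/funext => r; rewrite scaleN1r.
Qed.

Lemma continuous_dot n (x y : K -> 'cV[K]_n) :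
  continuous_coords x -> continuous_coords y -> continuous (fun s => dot (x s) (y s)).
Proof.
move=> cx cy; rewrite (_ : (fun s => _) = fun s => \sum_i x s i 0 * y s i 0).
  by apply: continuous_sum => j s; apply: cvgM; [exact: cx|exact: cy].
by apply/funext => r; rewrite dotE.
Qed.

End ContinuousCurveOperations.

Section CurveDerivatives.
Variable K : realType.
Implicit Types (t : K).

Definition derive_coords n (x : K -> 'cV[K]_n) t (dx : 'cV[K]_n) :=
  forall i, is_derive t 1 (fun s => x s i 0) (dx i 0).

Lemma derive_coordsD n (x y : K -> 'cV[K]_n) t dx dy :
  derive_coords x t dx -> derive_coords y t dy ->
  derive_coords (fun s => x s + y s) t (dx + dy).
Proof.
move=> hx hy i; rewrite mxE (_ : (fun s => _) = fun s => x s i 0 + y s i 0).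
  exact: derive_ptD.
by apply/funext => s; rewrite mxE.
Qed.

Lemma derive_coords_mulmx n m (A : K -> 'M[K]_(m, n)) (dA : 'M[K]_(m, n))
    (x : K -> 'cV[K]_n) t dx :
  (forall i j, is_derive t 1 (fun s => A s i j) (dA i j)) -> derive_coords x t dx ->
  derive_coords (fun s => A s *m x s) t (dA *m x t + A t *m dx).
Proof.
move=> hA hx i; rewrite (_ : (fun s => _) = fun s => \sum_j A s i j * x s j 0); last first.
  by apply/funext => s; rewrite mxE.
rewrite !mxE -big_split; apply: derive_pt_sum => j.
exact: derive_ptM (hA i j) (hx j).
Qed.

Lemma derive_coords_mulmxl n m (A : 'M[K]_(m, n)) (x : K -> 'cV[K]_n) t dx :
  derive_coords x t dx -> derive_coords (fun s => A *m x s) t (A *m dx).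
Proof.
move=> hx; have := @derive_coords_mulmx _ _ (fun=> A) 0 _ _ _ _ hx.
rewrite mul0mx add0r; apply => i j; rewrite mxE; exact: derive_pt_cst.
Qed.

Lemma derive_coordsZ n a (x : K -> 'cV[K]_n) t dx :
  derive_coords x t dx -> derive_coords (fun s => a *: x s) t (a *: dx).
Proof.
move=> hx i; rewrite mxE (_ : (fun s => _) = fun s => a * x s i 0).
  exact: derive_ptZ.
by apply/funext => s; rewrite mxE.
Qed.

Lemma derive_coordsN n (x : K -> 'cV[K]_n) t dx :
  derive_coords x t dx -> derive_coords (fun s => - x s) t (- dx).
Proof.
move=> hx i; rewrite mxE (_ : (fun s => _) = fun s => - x s i 0).
  exact: is_deriveN.
by apply/funext => s; rewrite mxE.
Qed.

Lemma derive_coordsB n (x y : K -> 'cV[K]_n) t dx dy :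
  derive_coords x t dx -> derive_coords y t dy ->
  derive_coords (fun s => x s - y s) t (dx - dy).
Proof. by move=> hx /derive_coordsN; exact: derive_coordsD. Qed.

Lemma derive_pt_dot n (x y : K -> 'cV[K]_n) t dx dy :
  derive_coords x t dx -> derive_coords y t dy ->
  is_derive t 1 (fun s => dot (x s) (y s)) (dot dx (y t) + dot (x t) dy).
Proof.
move=> hx hy; rewrite (_ : (fun s => _) = fun s => \sum_i x s i 0 * y s i 0); last first.
  by apply/funext => s; rewrite dotE.
rewrite !dotE -big_split; apply: derive_pt_sum => i; exact: derive_ptM.
Qed.

End CurveDerivatives.

Lemma young (K : realType) (al be x y : K) : 0 < al ->
  be * x * y <= al * x ^+ 2 + be ^+ 2 / (4%:R * al) * y ^+ 2.
Proof.
move=> al0; rewrite -subr_ge0.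
have -> : al * x ^+ 2 + be ^+ 2 / (4%:R * al) * y ^+ 2 - be * x * y =
  al * (x - be / (2%:R * al) * y) ^+ 2 by field; rewrite gt_eqF.
by rewrite mulr_ge0 ?sqr_ge0// ltW.
Qed.

Section LyapunovFunction.
Variables (K : realType) (J G : 'M[K]_3) (k1 c a nu eps : K).
Implicit Types (U : 'M[K]_3) (v z p : 'cV[K]_3).

(** The feedback to first order, up to the factor - eps ^+ 2. *)
Definition torque v p := k1 *: v + c *: p.

(** Paired with J z, the derivative of v contributes z.Jz / 2 and that of - 2 p
    contributes - z.Jz, so the sum damps z; and J z' paired with v gives
    - k1 v.Gv, which damps v. *)
Definition multiplier v p := nu *: (v - 2%:R *: p).

(** For the averaged linearization, the first line is the energy, whose
    derivative only dissipates p and p4; the term in the multiplier makes z and v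
    dissipate as well.  The last term absorbs the oscillation of the field
    around its mean. *)
Definition lyap U v z p (p4 : K) : K :=
  2%:R^-1 * dot z (J *m z) + k1 * dot v (G *m v) + c * dot p (G *m p) + p4 ^+ 2
  + dot (multiplier v p) (J *m z)
  + eps * dot (z + multiplier v p) (U *m torque v p).

Definition lyap_rate U dU v z p (p4 : K) dv dz dp (dp4 : K) : K :=
  2%:R^-1 * (dot dz (J *m z) + dot z (J *m dz))
  + k1 * (dot dv (G *m v) + dot v (G *m dv))
  + c * (dot dp (G *m p) + dot p (G *m dp)) + (dp4 * p4 + p4 * dp4)
  + (dot (multiplier dv dp) (J *m z) + dot (multiplier v p) (J *m dz))
  + eps * (dot (dz + multiplier dv dp) (U *m torque v p)
           + dot (z + multiplier v p) (dU *m torque v p + U *m torque dv dp)).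

Lemma derive_lyap (U : K -> 'M[K]_3) (dU : 'M[K]_3) (v z p : K -> 'cV[K]_3) (p4 : K -> K) (t : K)
    dv dz dp dp4 :
  (forall i j, is_derive t 1 (fun s => U s i j) (dU i j)) ->
  derive_coords v t dv -> derive_coords z t dz -> derive_coords p t dp ->
  is_derive t 1 p4 dp4 ->
  is_derive t 1 (fun s => lyap (U s) (v s) (z s) (p s) (p4 s))
    (lyap_rate (U t) dU (v t) (z t) (p t) (p4 t) dv dz dp dp4).
Proof.
move=> hU hv hz hp hp4.
have hm : derive_coords (fun s => multiplier (v s) (p s)) t (multiplier dv dp).
  by apply: derive_coordsZ; apply: derive_coordsB => //; exact: derive_coordsZ.
have hw : derive_coords (fun s => torque (v s) (p s)) t (torque dv dp).
  by apply: derive_coordsD; exact: derive_coordsZ.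
have hJz := derive_coords_mulmxl J hz.
apply: derive_ptD; last first.
  apply: derive_ptZ; apply: derive_pt_dot; first exact: derive_coordsD.
  exact: derive_coords_mulmx.
apply: derive_ptD; last exact: derive_pt_dot.
apply: derive_ptD; last by under eq_fun do rewrite expr2; exact: derive_ptM.
apply: derive_ptD; last first.
  by apply: derive_ptZ; apply: derive_pt_dot => //; exact: derive_coords_mulmxl.
apply: derive_ptD; last first.
  by apply: derive_ptZ; apply: derive_pt_dot => //; exact: derive_coords_mulmxl.
by apply: derive_ptZ; apply: derive_pt_dot.
Qed.

Lemma lyap_continuous (U : K -> 'M[K]_3) (v z p : K -> 'cV[K]_3) (p4 : K -> K) :
  (forall i j, continuous (fun s => U s i j)) ->
  continuous_coords v -> continuous_coords z -> continuous_coords p -> continuous p4 ->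
  continuous (fun s => lyap (U s) (v s) (z s) (p s) (p4 s)).
Proof.
move=> cU cv cz cp cp4.
have cm : continuous_coords (fun s => multiplier (v s) (p s)).
  by apply: continuous_coordsZ; apply: continuous_coordsB => //; exact: continuous_coordsZ.
have cw : continuous_coords (fun s => torque (v s) (p s)).
  by apply: continuous_coordsD; exact: continuous_coordsZ.
have cJz : continuous_coords (fun s => J *m z s) by exact: continuous_coords_mulmxl.
have cG x : continuous_coords x -> continuous (fun s => dot (x s) (G *m x s)).
  by move=> cx; apply: continuous_dot => //; exact: continuous_coords_mulmxl.
move=> s; apply: cvgD; last first.
  apply: cvgZr; apply: continuous_dot; first exact: continuous_coordsD.
  exact: continuous_coords_mulmx.
apply: cvgD; last exact: continuous_dot.
apply: cvgD; last by apply: (@cvgM _ _ _ _ p4 p4); exact: cp4.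
apply: cvgD; last by apply: cvgZr; exact: cG.
apply: cvgD; last by apply: cvgZr; exact: cG.
by apply: cvgZr; exact: continuous_dot.
Qed.

Hypothesis J_sym : J^T = J.
Hypothesis G_sym : G^T = G.

(** Gm is the instantaneous value of the field.  Its deviation from the mean G
    enters through J z' with the sign opposite to that of the derivative of U,
    so that only G is left at first order in eps. *)
Lemma lyap_rate_expand U Gm v z p (p4 : K) dv dz dp (dp4 : K) r1 r2 (r4 : K) :
  dv = (eps / 2%:R) *: z + r1 ->
  dp = (eps / 2%:R) *: z - (eps * a) *: p + r1 ->
  J *m dz = - (eps *: (Gm *m torque v p)) + r2 ->
  dp4 = - (eps * a * p4) + r4 ->
  lyap_rate U (Gm - G) v z p p4 dv dz dp dp4 =
  eps * (- (2%:R * c * a * dot p (G *m p)) - 2%:R * a * p4 ^+ 2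
         - nu / 2%:R * dot z (J *m z) + 2%:R * nu * a * dot p (J *m z)
         - nu * k1 * dot v (G *m v) + nu * (2%:R * k1 - c) * dot v (G *m p)
         + 2%:R * nu * c * dot p (G *m p))
  + (dot z r2 + 2%:R * k1 * dot v (G *m r1) + 2%:R * c * dot p (G *m r1)
     + 2%:R * p4 * r4 - nu * dot r1 (J *m z) + dot (multiplier v p) r2
     + eps * (dot (dz + multiplier dv dp) (U *m torque v p)
              + dot (z + multiplier v p) (U *m torque dv dp))).
Proof.
move=> edv edp eJdz edp4; rewrite /lyap_rate.
rewrite (dot_sym dz z J_sym) (dot_sym dv v G_sym) (dot_sym dp p G_sym).
rewrite [X in eps * (_ + X)]dotDr eJdz mulmxBl [dot _ (_ - _)]dotBr.
set A := dot (dz + _) _; set B := dot _ (U *m torque dv dp).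
rewrite edv edp edp4 /multiplier /torque.
rewrite !(mulmxDr, mulmxBr, mulmxN) -!scalemxAr !dot_lin.
rewrite (dot_sym p v G_sym) (dot_sym v z G_sym) (dot_sym p z G_sym).
by field.
Qed.

End LyapunovFunction.

Section EnormBounds.
Variable K : realType.

Lemma dot_norm_le n (u w : 'cV[K]_n) A B :
  enorm u <= A -> enorm w <= B -> `|dot u w| <= A * B.
Proof.
move=> uA wB; apply: (le_trans (cauchy_schwarz u w)).
by apply: ler_pM => //; exact: enorm_ge0.
Qed.

Lemma dot_ub n (u w : 'cV[K]_n) A B : enorm u <= A -> enorm w <= B -> dot u w <= A * B.
Proof. by move=> uA wB; apply: le_trans (ler_norm _) (dot_norm_le uA wB). Qed.

Lemma dot_lb n (u w : 'cV[K]_n) A B : enorm u <= A -> enorm w <= B -> - (A * B) <= dot u w.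
Proof. by move=> uA wB; have := dot_norm_le uA wB; rewrite ler_norml => /andP[]. Qed.

Lemma enormD_le n (u w : 'cV[K]_n) A B : enorm u <= A -> enorm w <= B -> enorm (u + w) <= A + B.
Proof. by move=> uA wB; apply: (le_trans (enormD _ _)); exact: lerD. Qed.

Lemma enormB_le n (u w : 'cV[K]_n) A B : enorm u <= A -> enorm w <= B -> enorm (u - w) <= A + B.
Proof. by move=> uA wB; apply: (le_trans (enormB _ _)); exact: lerD. Qed.

Lemma enormZ_le n b (u : 'cV[K]_n) A : 0 <= b -> enorm u <= A -> enorm (b *: u) <= b * A.
Proof. by move=> b0 uA; rewrite enormZ ger0_norm// ler_wpM2l. Qed.

Lemma enorm_mulmx_le m n (M : 'M[K]_(m, n)) (u : 'cV[K]_n) b A : 0 <= b ->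
  (forall w, enorm (M *m w) <= b * enorm w) -> enorm u <= A -> enorm (M *m u) <= b * A.
Proof. by move=> b0 Mb uA; apply: (le_trans (Mb u)); exact: ler_wpM2l. Qed.

End EnormBounds.

Section LyapunovBounds.
Variables (K : realType) (J G : 'M[K]_3) (k1 c a nu eps : K).
Variables (Jmin Jmax g g1 gm um : K).
Hypotheses (k1_gt0 : 0 < k1) (c_gt0 : 0 < c) (a_gt0 : 0 < a).
Hypotheses (nu_gt0 : 0 < nu) (nu_le1 : nu <= 1) (eps_gt0 : 0 < eps) (eps_le1 : eps <= 1).
Hypotheses (Jmin_gt0 : 0 < Jmin) (Jmax_ge0 : 0 <= Jmax) (g_gt0 : 0 < g) (g1_ge0 : 0 <= g1).
Hypotheses (gm_ge0 : 0 <= gm) (um_ge0 : 0 <= um).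
Hypotheses (J_sym : J^T = J) (G_sym : G^T = G).
Hypothesis J_lower : forall u, Jmin * dot u u <= dot u (J *m u).
Hypothesis J_upper : forall u, enorm (J *m u) <= Jmax * enorm u.
Hypothesis G_lower : forall u, g * dot u u <= dot u (G *m u).
Hypothesis G_upper : forall u, enorm (G *m u) <= g1 * enorm u.

Variables (U : 'M[K]_3) (v z p : 'cV[K]_3) (p4 : K).
Hypothesis U_upper : forall u, enorm (U *m u) <= um * enorm u.

Definition sqdist := dot v v + dot z z + dot p p + p4 ^+ 2.

Let N := Num.sqrt sqdist.

Let sqdist_ge0 : 0 <= sqdist.
Proof. by rewrite /sqdist !addr_ge0// ?dot_ge0// sqr_ge0. Qed.

Let N_ge0 : 0 <= N. Proof. exact: sqrtr_ge0. Qed.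

Let N_sqr : N ^+ 2 = sqdist. Proof. exact: sqr_sqrtr. Qed.

Let v_le : enorm v <= N.
Proof.
by rewrite ler_wsqrtr// /sqdist; have := dot_ge0 z; have := dot_ge0 p; have := sqr_ge0 p4; lra.
Qed.

Let z_le : enorm z <= N.
Proof.
by rewrite ler_wsqrtr// /sqdist; have := dot_ge0 v; have := dot_ge0 p; have := sqr_ge0 p4; lra.
Qed.

Let p_le : enorm p <= N.
Proof.
by rewrite ler_wsqrtr// /sqdist; have := dot_ge0 v; have := dot_ge0 z; have := sqr_ge0 p4; lra.
Qed.

Let p4_le : `|p4| <= N.
Proof.
rewrite -sqrtr_sqr ler_wsqrtr// /sqdist.
by have := dot_ge0 v; have := dot_ge0 z; have := dot_ge0 p; lra.
Qed.

Let torque_le (dv dp : 'cV[K]_3) A B : enorm dv <= A -> enorm dp <= B ->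
  enorm (torque k1 c dv dp) <= k1 * A + c * B.
Proof. by move=> hA hB; apply: enormD_le; apply: enormZ_le => //; exact: ltW. Qed.

Let multiplier_le (dv dp : 'cV[K]_3) A B : enorm dv <= A -> enorm dp <= B ->
  enorm (multiplier nu dv dp) <= nu * (A + 2%:R * B).
Proof.
move=> hA hB; apply: enormZ_le; first exact: ltW.
by apply: enormB_le => //; exact: enormZ_le.
Qed.

Let Jz_le : enorm (J *m z) <= Jmax * N. Proof. exact: enorm_mulmx_le. Qed.

Let Utorque_le : enorm (U *m torque k1 c v p) <= um * (k1 * N + c * N).
Proof. by apply: enorm_mulmx_le => //; exact: torque_le. Qed.

Let test_le : enorm (z + multiplier nu v p) <= 4%:R * N.
Proof.
apply: (le_trans (enormD_le z_le (multiplier_le v_le p_le))).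
have : nu * (N + 2%:R * N) <= 1 * (N + 2%:R * N) by rewrite ler_wpM2r// addr_ge0// mulr_ge0.
by lra.
Qed.

(** For small nu and eps the energy absorbs the indefinite cross terms. *)
Lemma lyap_ge b0 : b0 <= Jmin / 2%:R -> b0 <= k1 * g -> b0 <= c * g -> b0 <= 1 ->
  3%:R * nu * Jmax <= b0 / 4%:R -> 4%:R * eps * um * (k1 + c) <= b0 / 4%:R ->
  b0 / 2%:R * sqdist <= lyap J G k1 c nu eps U v z p p4.
Proof.
move=> h1 h2 h3 h4 h5 h6.
have i1 := dot_lb (multiplier_le v_le p_le) Jz_le.
have i2 := dot_lb test_le Utorque_le.
have i2' := ler_wpM2l (ltW eps_gt0) i2.
have j1 : 3%:R * nu * Jmax * N ^+ 2 <= b0 / 4%:R * N ^+ 2 by rewrite ler_wpM2r ?sqr_ge0.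
have j2 : 4%:R * eps * um * (k1 + c) * N ^+ 2 <= b0 / 4%:R * N ^+ 2.
  by rewrite ler_wpM2r ?sqr_ge0.
have e1 : b0 * dot z z <= 2%:R^-1 * dot z (J *m z).
  have := J_lower z; have := dot_ge0 z => z0.
  have : b0 * dot z z <= Jmin / 2%:R * dot z z by rewrite ler_wpM2r.
  by lra.
have e2 : b0 * dot v v <= k1 * dot v (G *m v).
  apply: (@le_trans _ _ (k1 * (g * dot v v))); last by rewrite ler_wpM2l// ltW.
  by rewrite mulrA ler_wpM2r ?dot_ge0.
have e3 : b0 * dot p p <= c * dot p (G *m p).
  apply: (@le_trans _ _ (c * (g * dot p p))); last by rewrite ler_wpM2l// ltW.
  by rewrite mulrA ler_wpM2r ?dot_ge0.
have e4 : b0 * p4 ^+ 2 <= p4 ^+ 2 by rewrite ler_piMl ?sqr_ge0.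
rewrite -N_sqr /lyap; move: N_sqr; rewrite /sqdist => Ns.
have eN : b0 * N ^+ 2 = b0 * dot v v + b0 * dot z z + b0 * dot p p + b0 * p4 ^+ 2.
  by rewrite Ns; ring.
lra.
Qed.

Lemma lyap_le : lyap J G k1 c nu eps U v z p p4 <=
  (4%:R * Jmax + (k1 + c) * g1 + 1 + 4%:R * um * (k1 + c)) * sqdist.
Proof.
have i0 := dot_ub z_le Jz_le.
have i1 := dot_ub (multiplier_le v_le p_le) Jz_le.
have i2 := dot_ub test_le Utorque_le.
have i3 := dot_ub v_le (enorm_mulmx_le g1_ge0 G_upper v_le).
have i4 := dot_ub p_le (enorm_mulmx_le g1_ge0 G_upper p_le).
have i3' := ler_wpM2l (ltW k1_gt0) i3.
have i4' := ler_wpM2l (ltW c_gt0) i4.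
have i2' : eps * dot (z + multiplier nu v p) (U *m torque k1 c v p) <=
    4%:R * N * (um * (k1 * N + c * N)).
  apply: (le_trans (ler_wpM2l (ltW eps_gt0) i2)).
  by rewrite ler_piMl// mulr_ge0// mulr_ge0// addr_ge0// mulr_ge0// ltW.
have i1' : dot (multiplier nu v p) (J *m z) <= (N + 2%:R * N) * (Jmax * N).
  apply: (le_trans i1); rewrite -mulrA ler_piMl//.
  by rewrite !mulr_ge0// addr_ge0// mulr_ge0.
have i5 : p4 ^+ 2 <= N ^+ 2.
  by rewrite N_sqr /sqdist; have := dot_ge0 v; have := dot_ge0 z; have := dot_ge0 p; lra.
have JN : 0 <= Jmax * N ^+ 2 by rewrite mulr_ge0// sqr_ge0.
by rewrite -N_sqr /lyap; lra.
Qed.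

(** The energy dissipates p and p4 at a rate independent of nu, and the
    multiplier dissipates z and v at a rate proportional to nu, at the price of
    indefinite terms that for small nu are paid for by the dissipation of p. *)
Lemma averaged_rate_le kappa :
  nu * (4%:R * a ^+ 2 * Jmax ^+ 2 / Jmin
        + (2%:R * k1 + c) ^+ 2 * g1 ^+ 2 / (2%:R * k1 * g) + 2%:R * c * g1) <= c * a * g ->
  kappa <= c * a * g -> kappa <= 2%:R * a -> kappa <= nu * Jmin / 4%:R ->
  kappa <= nu * k1 * g / 2%:R ->
  - (2%:R * c * a * dot p (G *m p)) - 2%:R * a * p4 ^+ 2
    - nu / 2%:R * dot z (J *m z) + 2%:R * nu * a * dot p (J *m z)
    - nu * k1 * dot v (G *m v) + nu * (2%:R * k1 - c) * dot v (G *m p)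
    + 2%:R * nu * c * dot p (G *m p) <= - (kappa * sqdist).
Proof.
move=> hnu h1 h2 h3 h4.
set X := enorm v; set Z := enorm z; set P := enorm p.
have [X0 Z0 P0] : [/\ 0 <= X, 0 <= Z & 0 <= P] by split; exact: enorm_ge0.
have t1 : 2%:R * c * a * (g * P ^+ 2) <= 2%:R * c * a * dot p (G *m p).
  by rewrite ler_wpM2l ?sqr_enorm// !mulr_ge0// ltW.
have t2 : nu / 2%:R * (Jmin * Z ^+ 2) <= nu / 2%:R * dot z (J *m z).
  by rewrite ler_wpM2l ?sqr_enorm// divr_ge0// ltW.
have t3 : nu * k1 * (g * X ^+ 2) <= nu * k1 * dot v (G *m v).
  by rewrite ler_wpM2l ?sqr_enorm// mulr_ge0// ltW.
have t4 : nu * (2%:R * a * dot p (J *m z)) <=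
    nu * (Jmin / 4%:R * Z ^+ 2 + 4%:R * a ^+ 2 * Jmax ^+ 2 / Jmin * P ^+ 2).
  rewrite ler_wpM2l ?(ltW nu_gt0)//.
  have y := @young K (Jmin / 4%:R) (2%:R * a * Jmax) Z P (divr_gt0 Jmin_gt0 (ltr0Sn _ _)).
  have d := dot_ub (lexx (enorm p)) (J_upper z); rewrite -/P -/Z in d.
  have := ler_wpM2l (mulr_ge0 (ler0n _ 2) (ltW a_gt0)) d.
  have -> : 2%:R * a * (P * (Jmax * Z)) = 2%:R * a * Jmax * Z * P by ring.
  move=> /le_trans; apply; apply: (le_trans y); rewrite lerD2l le_eqVlt; apply/orP; left; apply/eqP.
  by field; rewrite gt_eqF.
have t5 : nu * ((2%:R * k1 - c) * dot v (G *m p)) <= nu * (k1 * g / 2%:R * X ^+ 2 +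
    (2%:R * k1 + c) ^+ 2 * g1 ^+ 2 / (2%:R * k1 * g) * P ^+ 2).
  rewrite ler_wpM2l ?(ltW nu_gt0)//.
  have kg0 : 0 < k1 * g / 2%:R by rewrite divr_gt0// mulr_gt0.
  have y := @young K _ ((2%:R * k1 + c) * g1) X P kg0.
  have d := dot_norm_le (lexx (enorm v)) (G_upper p); rewrite -/P -/X in d.
  apply: (le_trans (ler_norm _)); rewrite normrM.
  have k : `|2%:R * k1 - c| <= 2%:R * k1 + c.
    by rewrite ler_norml; have := k1_gt0; have := c_gt0; move=> ? ?; apply/andP; split; lra.
  apply: (le_trans (ler_pM (normr_ge0 _) (normr_ge0 _) k d)).
  have -> : (2%:R * k1 + c) * (X * (g1 * P)) = (2%:R * k1 + c) * g1 * X * P by ring.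
  apply: (le_trans y); rewrite lerD2l le_eqVlt; apply/orP; left; apply/eqP.
  by field; rewrite !gt_eqF.
have t6 : nu * (2%:R * c * dot p (G *m p)) <= nu * (2%:R * c * (g1 * P ^+ 2)).
  rewrite ler_wpM2l ?(ltW nu_gt0)// ler_wpM2l ?mulr_ge0// ?(ltW c_gt0)//.
  by have := dot_ub (lexx (enorm p)) (G_upper p); rewrite -/P; lra.
have t7 := ler_wpM2r (sqr_ge0 P) hnu.
have s1 := ler_wpM2r (sqr_ge0 P) h1.
have s2 := ler_wpM2r (sqr_ge0 p4) h2.
have s3 := ler_wpM2r (sqr_ge0 Z) h3.
have s4 := ler_wpM2r (sqr_ge0 X) h4.
rewrite (_ : sqdist = X ^+ 2 + Z ^+ 2 + P ^+ 2 + p4 ^+ 2); last by rewrite !sqr_enorm.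
move: t4 t5 t7.
set A1 := 4%:R * a ^+ 2 * Jmax ^+ 2 / Jmin.
set A2 := (2%:R * k1 + c) ^+ 2 * g1 ^+ 2 / (2%:R * k1 * g).
by move=> t4 t5 t7; lra.
Qed.

(** With remainders quadratic in the state, everything but the averaged rate is
    either of higher order in eps or cubic in the state. *)
Lemma lyap_rate_le Gm dv dz dp dp4 r1 r2 r4 Cr kappa :
  (forall u, enorm (Gm *m u) <= gm * enorm u) ->
  dv = (eps / 2%:R) *: z + r1 ->
  dp = (eps / 2%:R) *: z - (eps * a) *: p + r1 ->
  J *m dz = - (eps *: (Gm *m torque k1 c v p)) + r2 ->
  dp4 = - (eps * a * p4) + r4 -> sqdist <= 1 ->
  enorm r1 <= eps * sqdist -> enorm r2 <= eps * (Cr * sqdist) -> `|r4| <= eps * sqdist ->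
  0 <= Cr ->
  - (2%:R * c * a * dot p (G *m p)) - 2%:R * a * p4 ^+ 2
    - nu / 2%:R * dot z (J *m z) + 2%:R * nu * a * dot p (J *m z)
    - nu * k1 * dot v (G *m v) + nu * (2%:R * k1 - c) * dot v (G *m p)
    + 2%:R * nu * c * dot p (G *m p) <= - (kappa * sqdist) ->
  lyap_rate J G k1 c nu eps U (Gm - G) v z p p4 dv dz dp dp4 <=
  eps * sqdist * (- kappa
    + eps * (((gm * (k1 + c) + Cr) / Jmin + 6%:R + 2%:R * a) * um * (k1 + c)
             + 4%:R * um * (2%:R * k1 + c * (2%:R + a)))
    + (4%:R * Cr + 2%:R * (k1 + c) * g1 + 2%:R + Jmax) * Num.sqrt sqdist).
Proof.
move=> Gm_upper edv edp eJdz edp4 sq1 hr1 hr2 hr4 Cr0 avg.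
rewrite (@lyap_rate_expand K J G k1 c a nu eps J_sym G_sym U Gm v z p p4
  dv dz dp dp4 r1 r2 r4)// -/N.
have N1 : N <= 1 by rewrite -sqrtr1 ler_wsqrtr.
have e0 := ltW eps_gt0.
rewrite -N_sqr in hr1 hr2 hr4 avg *.
have N2N : N ^+ 2 <= N by rewrite expr2 ler_piMl.
have N20 : 0 <= N ^+ 2 by exact: sqr_ge0.
have dv_le : enorm dv <= eps * (2%:R * N).
  rewrite edv; apply: (le_trans (enormD_le (enormZ_le _ z_le) hr1)); first by rewrite divr_ge0.
  rewrite (_ : _ + _ = eps * (2%:R^-1 * N + N ^+ 2)); last by field.
  by rewrite ler_wpM2l//; lra.
have dp_le : enorm dp <= eps * ((2%:R + a) * N).
  have ea0 : 0 <= eps * a by rewrite mulr_ge0// ltW.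
  have e20 : 0 <= eps / 2%:R by rewrite divr_ge0.
  rewrite edp; apply: (le_trans (enormD_le
    (enormB_le (enormZ_le e20 z_le) (enormZ_le ea0 p_le)) hr1)).
  rewrite (_ : _ + _ = eps * ((2%:R^-1 + a) * N + N ^+ 2)); last by field.
  by rewrite ler_wpM2l//; lra.
have dz_le : enorm dz <= eps * ((gm * (k1 + c) + Cr) / Jmin * N).
  have Jdz : enorm (J *m dz) <= eps * ((gm * (k1 + c) + Cr) * N).
    rewrite eJdz; apply: (@le_trans _ _ (eps * (gm * (k1 * N + c * N)) + eps * (Cr * N ^+ 2))).
      apply: enormD_le => //; rewrite enormN; apply: enormZ_le => //.
      by apply: enorm_mulmx_le => //; exact: torque_le.
    rewrite -mulrDr ler_wpM2l//.
    by have := ler_wpM2l Cr0 N2N; lra.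
  have := J_lower dz; rewrite -sqr_enorm => jl.
  have := dot_ub (lexx (enorm dz)) Jdz => ju.
  have [->|dz0] := eqVneq dz 0.
    by rewrite enorm0 !mulr_ge0// ?invr_ge0 ?(ltW Jmin_gt0)// addr_ge0// mulr_ge0// addr_ge0// ltW.
  have ndz : 0 < enorm dz by rewrite lt_neqAle eq_sym enorm_eq0 dz0 enorm_ge0.
  have {}jl : enorm dz * (Jmin * enorm dz) <= enorm dz * (eps * ((gm * (k1 + c) + Cr) * N)).
    by apply: le_trans ju; lra.
  rewrite ler_pM2l// in jl.
  rewrite (_ : eps * _ = eps * ((gm * (k1 + c) + Cr) * N) / Jmin); last by ring.
  by rewrite ler_pdivlMr// mulrC.
set D := (gm * (k1 + c) + Cr) / Jmin in dz_le *.
have D0 : 0 <= D.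
  by rewrite divr_ge0 ?(ltW Jmin_gt0)// addr_ge0// mulr_ge0// addr_ge0// ltW.
have dy_le : enorm (dz + multiplier nu dv dp) <= eps * ((D + 6%:R + 2%:R * a) * N).
  apply: (le_trans (enormD_le dz_le (multiplier_le dv_le dp_le))).
  rewrite [leRHS](_ : _ = eps * (D * N) +
    1 * (eps * (2%:R * N) + 2%:R * (eps * ((2%:R + a) * N)))); last by ring.
  rewrite lerD2l ler_wpM2r// addr_ge0// !mulr_ge0// ?mulr_ge0//.
  by rewrite addr_ge0// ltW.
have w_le := Utorque_le.
have dw_le : enorm (U *m torque k1 c dv dp) <=
    um * (k1 * (eps * (2%:R * N)) + c * (eps * ((2%:R + a) * N))).
  by apply: enorm_mulmx_le => //; exact: torque_le.
have b1 := ler_wpM2l e0 (dot_ub dy_le w_le).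
have b2 := ler_wpM2l e0 (dot_ub test_le dw_le).
have b3 := dot_ub z_le hr2.
have Gr1 := enorm_mulmx_le g1_ge0 G_upper hr1.
have b4 := ler_wpM2l (ltW k1_gt0) (dot_ub v_le Gr1).
have b5 := ler_wpM2l (ltW c_gt0) (dot_ub p_le Gr1).
have b6 : p4 * r4 <= N * (eps * N ^+ 2).
  by apply: (le_trans (ler_norm _)); rewrite normrM; apply: ler_pM.
have b7 : - (nu * dot r1 (J *m z)) <= eps * N ^+ 2 * (Jmax * N).
  have := dot_lb hr1 Jz_le => h.
  have := ler_wpM2l (ltW nu_gt0) h.
  have : nu * (eps * N ^+ 2 * (Jmax * N)) <= 1 * (eps * N ^+ 2 * (Jmax * N)).
    by rewrite ler_wpM2r// !mulr_ge0.
  by lra.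
have b8 : dot (multiplier nu v p) r2 <= 3%:R * N * (eps * (Cr * N ^+ 2)).
  apply: (le_trans (dot_ub (multiplier_le v_le p_le) hr2)).
  rewrite (_ : 3%:R * N * _ = 1 * (N + 2%:R * N) * (eps * (Cr * N ^+ 2))); last by ring.
  rewrite ler_wpM2r// ?mulr_ge0// ler_wpM2r//.
  by rewrite addr_ge0// mulr_ge0.
have b9 := ler_wpM2l e0 avg.
move: b1 b2; set y1 := dot _ (U *m torque k1 c v p); set y2 := dot _ (U *m torque k1 c dv dp).
move: b9; set lead := - _ - _ - _ + _ - _ + _ + _.
by move=> b9 b1 b2; lra.
Qed.

End LyapunovBounds.

(** * Error dynamics of the closed loop *)

Section Quaternions.
Variable K : realType.
Implicit Types (q r : 'cV[K]_4) (u w : 'cV[K]_3).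

Lemma dot_col_mx m n (u1 v1 : 'cV[K]_m) (u2 v2 : 'cV[K]_n) :
  dot (col_mx u1 u2) (col_mx v1 v2) = dot u1 v1 + dot u2 v2.
Proof. by rewrite /dot tr_col_mx mul_row_col mxE. Qed.

Lemma dot_split m n (x y : 'cV[K]_(m + n)) :
  dot x y = dot (usubmx x) (usubmx y) + dot (dsubmx x) (dsubmx y).
Proof. by rewrite -{1}(vsubmxK x) -{1}(vsubmxK y) dot_col_mx. Qed.

Lemma dot_quat q r : dot q r = dot (vpart q) (vpart r) + spart q * spart r.
Proof.
rewrite (@dot_split 3 1 q r); congr (_ + _).
by rewrite [LHS]dotE big_ord1.
Qed.

Lemma vpartB q r : vpart (q - r) = vpart q - vpart r.
Proof. by rewrite /vpart linearB. Qed.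

Lemma vpartZ b q : vpart (b *: q) = b *: vpart q.
Proof. by rewrite /vpart linearZ. Qed.

Lemma spartB q r : spart (q - r) = spart q - spart r.
Proof. by rewrite /spart linearB !mxE. Qed.

Lemma spartZ b q : spart (b *: q) = b * spart q.
Proof. by rewrite /spart linearZ !mxE. Qed.

Lemma vpart_qbar : vpart (qbar K) = 0.
Proof. exact: (@col_mxKu _ 3 1 1). Qed.

Lemma spart_qbar : spart (qbar K) = 1.
Proof. by rewrite /spart /qbar (@col_mxKd _ 3 1 1) mxE. Qed.

Lemma vpart_Wmx q w :
  vpart (Wmx q *m w) = 2%:R^-1 *: (spart q *: w + crossmx (vpart q) *m w).
Proof.
rewrite /vpart /Wmx -scalemxAl linearZ /= (@mul_col_mx _ 3 1 3 1) (@col_mxKu _ 3 1 1).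
by rewrite mulmxDl mul_scalar_mx.
Qed.

Lemma spart_Wmx q w : spart (Wmx q *m w) = - (2%:R^-1 * dot (vpart q) w).
Proof.
rewrite {1}/spart /Wmx -scalemxAl linearZ /= (@mul_col_mx _ 3 1 3 1) (@col_mxKd _ 3 1 1).
by rewrite mxE mulNmx mxE mulrN.
Qed.

Lemma tr_Wmx_mul q r : (Wmx q)^T *m r =
  2%:R^-1 *: (spart q *: vpart r - crossmx (vpart q) *m vpart r - spart r *: vpart q).
Proof.
rewrite /Wmx linearZ /= -scalemxAl; congr (_ *: _).
rewrite (@tr_col_mx _ 3 1 3) -{1}(@vsubmxK _ 3 1 _ r) (@mul_row_col _ 3 3 1 1).
rewrite linearD /= tr_scalar_mx crossmx_tr mulmxDl mul_scalar_mx mulNmx; congr (_ + _).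
rewrite linearN /= trmxK mulNmx; congr (- _).
rewrite (mx11_scalar (dsubmx _)) mul_mx_scalar; congr (_ *: _).
Qed.

(** The kinematics are tangent to the unit sphere. *)
Lemma dot_Wmx q w : dot q (Wmx q *m w) = 0.
Proof.
rewrite dot_quat vpart_Wmx spart_Wmx dotZr dotDr dotZr dot_cross; ring.
Qed.

(** On the unit sphere, A(q) - I = - 2 |v|^2 I + 2 v v^T - 2 s v^x, where v^x u = v x u,
    and every term has a factor v. *)
Lemma Amx_near_id q u : enorm q = 1 -> enorm (vpart q) <= 1 ->
  enorm (Amx q *m u - u) <= 6%:R * enorm (vpart q) * enorm u /\
  enorm ((Amx q)^T *m u - u) <= 6%:R * enorm (vpart q) * enorm u.
Proof.
move=> q1 v1; have := dot_quat q q; rewrite -sqr_enorm q1 expr1n.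
set v := vpart q in v1 *; set s := spart q => sv.
have vv : dot v v = 1 - s ^+ 2 by rewrite sv; ring.
have s1 : `|s| <= 1.
  by rewrite -sqrtr_sqr -sqrtr1 ler_wsqrtr//; have := dot_ge0 v; lra.
have outer : (v *m v^T) *m u = dot v u *: v.
  by rewrite -mulmxA [v^T *m u]mx11_scalar mul_mx_scalar.
have bound b : `|b| <= 2%:R ->
    enorm ((- (2%:R * dot v v)) *: u + 2%:R *: (dot v u *: v) + b *: (crossmx v *m u)) <=
    6%:R * enorm v * enorm u.
  move=> b2; set X := enorm v in v1 *.
  have X0 : 0 <= X := enorm_ge0 v; have u0 := enorm_ge0 u.
  have XX : X ^+ 2 <= X by rewrite expr2 ler_piMl.
  have e1 : enorm ((- (2%:R * dot v v)) *: u) <= 2%:R * X * enorm u.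
    rewrite enormZ normrN ger0_norm ?mulr_ge0 ?dot_ge0// -sqr_enorm -/X ler_wpM2r//.
    by rewrite ler_wpM2l.
  have e2 : enorm (2%:R *: (dot v u *: v)) <= 2%:R * X * enorm u.
    rewrite !enormZ ger0_norm// -mulrA ler_wpM2l//.
    apply: (@le_trans _ _ ((X * enorm u) * X)).
      by rewrite ler_wpM2r// cauchy_schwarz.
    by rewrite mulrAC -expr2 ler_wpM2r.
  have e3 : enorm (b *: (crossmx v *m u)) <= 2%:R * X * enorm u.
    rewrite enormZ -mulrA; apply: ler_pM => //; first exact: enorm_ge0.
    exact: enorm_cross.
  by have := enormD_le (enormD_le e1 e2) e3; lra.
split.
- rewrite (_ : Amx q *m u - u = (- (2%:R * dot v v)) *: u + 2%:R *: (dot v u *: v)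
    + (- (2%:R * s)) *: (crossmx v *m u)); first by
      apply: bound; rewrite normrN normrM ger0_norm//; lra.
  rewrite /Amx -/v -/s mulmxBl mulmxDl mul_scalar_mx -!scalemxAl outer [(- (_ * s)) *: _]scaleNr.
  rewrite addrAC; congr (_ - _); rewrite addrAC; congr (_ + _).
  by rewrite vv -[X in _ - X]scale1r -scalerBl; congr (_ *: _); ring.
- rewrite (_ : (Amx q)^T *m u - u = (- (2%:R * dot v v)) *: u + 2%:R *: (dot v u *: v)
    + (2%:R * s) *: (crossmx v *m u)); first by apply: bound; rewrite normrM ger0_norm//; lra.
  have -> : (Amx q)^T = (s ^+ 2 - dot v v)%:M + 2%:R *: (v *m v^T) + (2%:R * s) *: crossmx v.
    rewrite /Amx -/v -/s linearB linearD /= !linearZ /= tr_scalar_mx trmx_mul trmxK.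
    by rewrite crossmx_tr opprK.
  rewrite !mulmxDl mul_scalar_mx -!scalemxAl outer.
  rewrite addrAC; congr (_ + _); rewrite addrAC; congr (_ + _).
  by rewrite vv -[X in _ - X]scale1r -scalerBl; congr (_ *: _); ring.
Qed.

End Quaternions.

Section ClosedLoopErrors.
Variables (K : realType) (Gm : K -> 'M[K]_3) (J : 'M[K]_3) (k1 k2 alpha lambda eps : K).
Variables (Jmax gm : K).
Hypotheses (k1_gt0 : 0 < k1) (k2_gt0 : 0 < k2) (alpha_gt0 : 0 < alpha) (lambda_gt0 : 0 < lambda).
Hypotheses (eps_gt0 : 0 < eps).
Hypothesis J_upper : forall u, enorm (J *m u) <= Jmax * enorm u.
Hypothesis Gm_upper : forall t u, enorm (Gm t *m u) <= gm * enorm u.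
Hypotheses (Jmax_ge0 : 0 <= Jmax) (gm_ge0 : 0 <= gm).
Implicit Types (x : 'cV[K]_(4 + 3 + 4)).

(** Rescaled coordinates in which every term of the closed loop is of order
    eps; filtered is the error of the filter generating delta. *)
Definition rescaled_rate x : 'cV[K]_3 := eps^-1 *: state_w x.
Definition filtered x : 'cV[K]_4 := state_q x - (eps * lambda) *: state_d x.
Definition attitude x : 'cV[K]_3 := vpart (state_q x).

Definition error_sqdist x :=
  sqdist (attitude x) (rescaled_rate x) (vpart (filtered x)) (spart (filtered x)).

Let c := k2 * alpha * lambda / 2%:R.

(** The remainders are quadratic: s - 1 is of order |v|^2, A(q) - I is of order
    |v| and multiplies a torque that is itself linear in the state, and the
    gyroscopic term is quadratic in z. *)
Lemma closed_loop_error_dynamics t x dx :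
  closed_loop Gm J k1 k2 alpha lambda eps t x dx ->
  enorm (state_q x) = 1 -> 0 <= spart (state_q x) -> error_sqdist x <= 1 ->
  exists r1 r2 r4,
  [/\ attitude dx = (eps / 2%:R) *: rescaled_rate x + r1,
      vpart (filtered dx) = (eps / 2%:R) *: rescaled_rate x
        - (eps * (alpha * lambda)) *: vpart (filtered x) + r1,
      J *m rescaled_rate dx
        = - (eps *: (Gm t *m torque k1 c (attitude x) (vpart (filtered x)))) + r2 &
      spart (filtered dx) = - (eps * (alpha * lambda) * spart (filtered x)) + r4] /\
  [/\ enorm r1 <= eps * error_sqdist x,
      enorm r2 <= eps * ((Jmax + gm * (147%:R * c + 48%:R * (k1 + c))) * error_sqdist x) &
      `|r4| <= eps * error_sqdist x].
Proof.
move=> [eq ew ed] q1 s0 sq1.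
pose v := attitude x; pose s := spart (state_q x); pose z := rescaled_rate x.
pose p := vpart (filtered x); pose p4 := spart (filtered x).
have c0 : 0 < c by rewrite divr_gt0// !mulr_gt0.
have wE : state_w x = eps *: z by rewrite scalerA divff ?scale1r// gt_eqF.
pose N := Num.sqrt (error_sqdist x).
have sqE : error_sqdist x = dot v v + dot z z + dot p p + p4 ^+ 2 by [].
have sq_ge0 : 0 <= error_sqdist x by rewrite sqE !addr_ge0 ?dot_ge0 ?sqr_ge0.
have N0 : 0 <= N by exact: sqrtr_ge0.
have NN : N ^+ 2 = error_sqdist x by exact: sqr_sqrtr.
have N1 : N <= 1 by rewrite -sqrtr1 ler_wsqrtr.
have [vN zN pN] : [/\ enorm v <= N, enorm z <= N & enorm p <= N].
  have := dot_ge0 v; have := dot_ge0 z; have := dot_ge0 p; have := sqr_ge0 p4.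
  by move=> *; split; rewrite ler_wsqrtr// sqE; lra.
have p4N : `|p4| <= N.
  have := dot_ge0 v; have := dot_ge0 z; have := dot_ge0 p.
  by move=> *; rewrite -sqrtr_sqr ler_wsqrtr// sqE; lra.
have v1 : enorm v <= 1 by exact: le_trans vN N1.
(* 1 - s <= 1 - s ^ 2 = |v| ^ 2, and |v| <= 1 *)
have s1v : `|s - 1| <= enorm v.
  have := dot_quat (state_q x) (state_q x); rewrite -sqr_enorm q1 expr1n -/v -/s.
  rewrite -[dot v v]sqr_enorm => e.
  have s1 : s <= 1 by have := sqr_ge0 (enorm v); nra.
  rewrite ler0_norm ?subr_le0// opprB.
  have vX : enorm v ^+ 2 <= enorm v by rewrite expr2 ler_piMl// enorm_ge0.
  by apply: le_trans vX; have := ler_piMl (s0 : 0 <= s) s1; lra.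
have prodN (A B : K) : 0 <= A -> 0 <= B -> A <= N -> B <= N -> A * B <= N ^+ 2.
  by move=> *; rewrite expr2; apply: ler_pM.
have XZ := prodN _ _ (enorm_ge0 v) (enorm_ge0 z) vN zN.
have XP := prodN _ _ (enorm_ge0 v) (enorm_ge0 p) vN pN.
have sZ n (u : 'cV[K]_n) : enorm ((s - 1) *: u) <= enorm v * enorm u.
  by rewrite enormZ ler_wpM2r ?enorm_ge0.
pose r1 := (eps / 2%:R) *: ((s - 1) *: z + crossmx v *m z).
have e2 : 0 <= eps / 2%:R by rewrite divr_ge0// ltW.
have dqv : attitude dx = (eps / 2%:R) *: z + r1.
  rewrite /attitude eq vpart_Wmx -/(attitude x) -/v -/s wE -scalemxAr.
  have -> : s *: (eps *: z) = eps *: (s *: z) by rewrite [LHS]scalerA [RHS]scalerA mulrC.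
  rewrite -scalerDr scalerA [2%:R^-1 * _]mulrC /r1 -scalerDr addrA; congr (_ *: (_ + _)).
  by rewrite scalerBl scale1r addrC subrK.
have dqs : spart (state_q dx) = - (eps / 2%:R * dot v z).
  by rewrite eq spart_Wmx -/v wE dotZr; congr (- _); ring.
have filt : filtered dx = state_q dx - (eps * (alpha * lambda)) *: filtered x.
  by rewrite /filtered ed scalerA; congr (_ - _ *: _); ring.
pose torque' := torque k1 c v p + c *: ((s - 1) *: p - crossmx v *m p - p4 *: v).
have uE : control k1 k2 alpha lambda eps (state_q x) (state_d x) = - (eps ^+ 2 *: torque').
  rewrite /control -/(filtered x) tr_Wmx_mul -/(attitude x) -/p -/p4 -/v -/s; congr (- (_ *: _)).
  rewrite /torque' /torque -[RHS]addrA; congr (_ + _).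
  rewrite scalerA -/c -scalerDr; congr (_ *: _).
  by rewrite scalerBl scale1r !addrA [p + _]addrC addrK.
pose A := Amx (state_q x).
pose r2 := - (eps *: (crossmx z *m (J *m z)
   + (A *m Gm t *m A^T *m torque' - Gm t *m torque k1 c v p))).
exists r1, r2, (- (eps / 2%:R * dot v z)); split; split.
- exact: dqv.
- rewrite filt vpartB vpartZ -/p -/(attitude dx) dqv addrAC.
  by [].
- have gyro (y : 'cV[K]_3) :
      crossmx (eps *: y) *m (J *m (eps *: y)) = eps ^+ 2 *: (crossmx y *m (J *m y)).
    have -> : crossmx (eps *: y) = eps *: crossmx y.
      by apply/matrixP => -[[|[|[|//]]] i] [[|[|[|//]]] j]; rewrite !mxE /= ?mulr0 ?mulrN.
    by rewrite -!scalemxAl -!scalemxAr scalerA expr2.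
  have -> : J *m rescaled_rate dx =
      - (eps *: (crossmx z *m (J *m z) + A *m Gm t *m A^T *m torque')).
    rewrite /rescaled_rate -scalemxAr ew wE uE -/A gyro mulmxN -[_ *m (_ *: torque')]scalemxAr.
    rewrite -opprD -scalerDr scalerN scalerA; congr (- (_ *: _)).
    by field; rewrite gt_eqF.
  rewrite /r2 -opprD -scalerDr; congr (- (_ *: _)).
  by rewrite addrCA [Gm t *m _ + _]addrC subrK.
- by rewrite filt spartB spartZ dqs -/p4 addrC.
- apply: (le_trans (enormZ_le e2 (enormD_le (sZ _ z) (enorm_cross v z)))).
  by rewrite -NN; have := ler_wpM2l (ltW eps_gt0) XZ; lra.
- rewrite enormN; apply: enormZ_le; first exact: ltW.
  rewrite -NN.
  have h1 : enorm (crossmx z *m (J *m z)) <= Jmax * N ^+ 2.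
    apply: (le_trans (enorm_cross _ _)).
    apply: (@le_trans _ _ (N * (Jmax * N))); last by lra.
    apply: ler_pM; rewrite ?enorm_ge0//.
    exact: enorm_mulmx_le.
  have wN : enorm (torque k1 c v p) <= (k1 + c) * N.
    by rewrite mulrDl; apply: enormD_le; apply: enormZ_le => //; exact: ltW.
  have dN : enorm (torque' - torque k1 c v p) <= 3%:R * c * N ^+ 2.
    rewrite addrC addKr; apply: (@le_trans _ _ (c * (N ^+ 2 + N ^+ 2 + N ^+ 2))); last by lra.
    apply: enormZ_le; first exact: ltW.
    apply: enormB_le; first apply: enormB_le.
    + exact: le_trans (sZ _ p) XP.
    + exact: le_trans (enorm_cross v p) XP.
    + by rewrite enormZ expr2; apply: ler_pM; rewrite ?enorm_ge0.
  have nearA u : enorm (A *m u - u) <= 6%:R * N * enorm u /\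
                 enorm (A^T *m u - u) <= 6%:R * N * enorm u.
    have [a1 a2] := Amx_near_id u q1 v1.
    by split; [apply: (le_trans a1)|apply: (le_trans a2)];
      rewrite ler_wpM2r ?enorm_ge0// ler_wpM2l.
  have N6 (y : 'cV[K]_3) : 6%:R * N * enorm y <= 6%:R * enorm y.
    by rewrite ler_wpM2r ?enorm_ge0//; lra.
  have A7 (y : 'cV[K]_3) : enorm (A *m y) <= 7%:R * enorm y.
    have := enormD_le (nearA y).1 (lexx (enorm y)); rewrite subrK.
    by have := N6 y; lra.
  have At7 (y : 'cV[K]_3) : enorm (A^T *m y) <= 7%:R * enorm y.
    have := enormD_le (nearA y).2 (lexx (enorm y)); rewrite subrK.
    by have := N6 y; lra.
  set w := torque k1 c v p in wN dN *.
  have -> : A *m Gm t *m A^T *m torque' - Gm t *m w =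
      A *m (Gm t *m (A^T *m (torque' - w))) + A *m (Gm t *m (A^T *m w - w))
      + (A *m (Gm t *m w) - Gm t *m w).
    by rewrite !mulmxBr !mulmxA !addrA subrK subrK.
  have i1 := enorm_mulmx_le (ler0n _ 7) A7
    (enorm_mulmx_le gm_ge0 (Gm_upper t) (enorm_mulmx_le (ler0n _ 7) At7 dN)).
  have i2' : enorm (A^T *m w - w) <= 6%:R * N * ((k1 + c) * N).
    by apply: (le_trans (nearA w).2); rewrite ler_wpM2l// mulr_ge0.
  have i2 := enorm_mulmx_le (ler0n _ 7) A7 (enorm_mulmx_le gm_ge0 (Gm_upper t) i2').
  have i3 : enorm (A *m (Gm t *m w) - Gm t *m w) <= 6%:R * N * (gm * ((k1 + c) * N)).
    apply: (le_trans (nearA _).1); rewrite ler_wpM2l ?mulr_ge0//.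
    exact: enorm_mulmx_le.
  by have := enormD_le h1 (enormD_le (enormD_le i1 i2) i3); lra.
- rewrite normrN normrM ger0_norm// -NN.
  have := dot_norm_le (lexx (enorm v)) (lexx (enorm z)) => h.
  have := ler_wpM2l (ltW eps_gt0) (le_trans h XZ).
  have : 0 <= eps * N ^+ 2 by rewrite mulr_ge0 ?sqr_ge0 ?ltW.
  by lra.
Qed.

End ClosedLoopErrors.

(** * Exponential stability *)

Section StateNorm.
Variables (K : realType) (lambda eps : K).
Hypotheses (lambda_gt0 : 0 < lambda) (eps_gt0 : 0 < eps).
Implicit Types (x y : 'cV[K]_(4 + 3 + 4)).

Lemma dot_state x y :
  dot x y = dot (state_q x) (state_q y) + dot (state_w x) (state_w y)
            + dot (state_d x) (state_d y).
Proof. by rewrite (@dot_split _ (4 + 3) 4) (@dot_split _ 4 3). Qed.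

Lemma dot_subr_le n (u w : 'cV[K]_n) : dot (u - w) (u - w) <= 2%:R * (dot u u + dot w w).
Proof. by have := dot_ge0 (u + w); rewrite !dot_lin (dotC w u); lra. Qed.

(** Unlike error_sqdist, it also sees the scalar part of q, so that it controls
    the whole state. *)
Definition full_sqdist x :=
  dot (state_q x - qbar K) (state_q x - qbar K)
  + dot (rescaled_rate eps x) (rescaled_rate eps x)
  + dot (filtered lambda eps x) (filtered lambda eps x).

Lemma full_sqdist_ge0 x : 0 <= full_sqdist x.
Proof. by rewrite !addr_ge0 ?dot_ge0. Qed.

Lemma full_sqdistE x : full_sqdist x =
  error_sqdist lambda eps x + (spart (state_q x) - 1) ^+ 2.
Proof.
rewrite /full_sqdist (dot_quat (_ - _)) vpartB spartB vpart_qbar spart_qbar subr0.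
by rewrite (dot_quat (filtered _ _ _)) /error_sqdist /sqdist /attitude; ring.
Qed.

(** On the unit sphere, s >= 0 implies 0 <= 1 - s <= 1 - s ^ 2 = |v| ^ 2. *)
Lemma full_sqdist_bounds x : enorm (state_q x) = 1 -> full_sqdist x < 1 ->
  [/\ 0 <= spart (state_q x), error_sqdist lambda eps x <= full_sqdist x &
      full_sqdist x <= 2%:R * error_sqdist lambda eps x].
Proof.
move=> q1; have := dot_quat (state_q x) (state_q x); rewrite -sqr_enorm q1 expr1n.
rewrite full_sqdistE; set s := spart _; set E := error_sqdist _ _ _ => sv lt1.
have vE : dot (vpart (state_q x)) (vpart (state_q x)) <= E.
  rewrite /E /error_sqdist /sqdist -/(attitude x).
  have := dot_ge0 (rescaled_rate eps x); have := dot_ge0 (vpart (filtered lambda eps x)).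
  by have := sqr_ge0 (spart (filtered lambda eps x)); lra.
have v0 := dot_ge0 (vpart (state_q x)).
have s0 : 0 <= s by have := sqr_ge0 (s - 1); nra.
have s1 : s <= 1 by nra.
split=> //; first by rewrite lerDl sqr_ge0.
have : (s - 1) ^+ 2 <= 1 - s * s by nra.
by lra.
Qed.

Let xbar := state (qbar K) 0 ((eps * lambda)^-1 *: qbar K).

Let el_gt0 : 0 < eps * lambda. Proof. exact: mulr_gt0. Qed.

Let filteredE x : filtered lambda eps x =
  (state_q x - qbar K) - (eps * lambda) *: state_d (x - xbar).
Proof.
rewrite /filtered /state_d linearB /= -/(state_d xbar) state_dE scalerBr scalerA.
by rewrite divff ?gt_eqF// scale1r opprB addrA subrK.
Qed.

Let dot_error x : dot (x - xbar) (x - xbar) =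
  dot (state_q x - qbar K) (state_q x - qbar K)
  + eps ^+ 2 * dot (rescaled_rate eps x) (rescaled_rate eps x)
  + dot (state_d (x - xbar)) (state_d (x - xbar)).
Proof.
have -> : eps ^+ 2 * dot (rescaled_rate eps x) (rescaled_rate eps x) = dot (state_w x) (state_w x).
  by rewrite /rescaled_rate dotZl dotZr; field; rewrite gt_eqF.
rewrite dot_state /state_q /state_w !linearB /= -/(state_q x) -/(state_w x).
by rewrite -/(state_q xbar) -/(state_w xbar) state_qE state_wE subr0.
Qed.

Lemma error_le_full_sqdist x : dot (x - xbar) (x - xbar) <=
  (1 + eps ^+ 2 + 2%:R / (eps * lambda) ^+ 2) * full_sqdist x.
Proof.
have h : dot (state_d (x - xbar)) (state_d (x - xbar)) <= 2%:R / (eps * lambda) ^+ 2 *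
    (dot (state_q x - qbar K) (state_q x - qbar K)
     + dot (filtered lambda eps x) (filtered lambda eps x)).
  have := dot_subr_le (state_q x - qbar K) (filtered lambda eps x).
  rewrite {1 2}filteredE subKr dotZl dotZr mulrA -expr2 => h.
  have e2 : 0 < (eps * lambda) ^+ 2 by rewrite exprn_gt0.
  by rewrite mulrAC ler_pdivlMr// mulrC.
rewrite dot_error /full_sqdist.
have := dot_ge0 (state_q x - qbar K); have := dot_ge0 (rescaled_rate eps x).
have := dot_ge0 (filtered lambda eps x).
set A := dot (state_q x - _) _ in h *; set B := dot (rescaled_rate _ _) _.
set D := dot (filtered _ _ _) _ in h *; set k := 2%:R / _ in h *.
have k0 : 0 <= k by rewrite divr_ge0// sqr_ge0.
move=> D0 B0 A0; have := sqr_ge0 eps; set e2 := eps ^+ 2 => e20.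
have := mulr_ge0 k0 B0; have := mulr_ge0 e20 A0; have := mulr_ge0 e20 D0.
by lra.
Qed.

Lemma full_sqdist_le_error x : full_sqdist x <=
  (3%:R + eps ^- 2 + 2%:R * (eps * lambda) ^+ 2) * dot (x - xbar) (x - xbar).
Proof.
have h := dot_subr_le (state_q x - qbar K) ((eps * lambda) *: state_d (x - xbar)).
rewrite -filteredE in h; rewrite dotZl dotZr mulrA -expr2 in h.
rewrite /full_sqdist dot_error.
set A := dot (state_q x - _) _ in h *; set B := dot (rescaled_rate _ _) _.
set C := dot (filtered _ _ _) _ in h *; set D := dot (state_d _) _ in h *.
have A0 : 0 <= A := dot_ge0 _; have B0 : 0 <= B := dot_ge0 _; have D0 : 0 <= D := dot_ge0 _.
set l2 := (eps * lambda) ^+ 2 in h *; set e := eps ^+ 2.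
have e0 : 0 < e by rewrite exprn_gt0.
have l20 : 0 <= l2 := sqr_ge0 _.
have eV : e^-1 * (e * B) = B by rewrite mulrA mulVf ?mul1r// gt_eqF.
have ei0 : 0 <= e^-1 by rewrite invr_ge0 ltW.
have := mulr_ge0 l20 A0; have := mulr_ge0 l20 (mulr_ge0 (ltW e0) B0).
have := mulr_ge0 ei0 A0; have := mulr_ge0 ei0 D0; have := mulr_ge0 (ltW e0) B0.
have -> : (3%:R + e^-1 + 2%:R * l2) * (A + e * B + D) = 3%:R * A + 3%:R * (e * B) + 3%:R * D
  + e^-1 * A + e^-1 * (e * B) + e^-1 * D + 2%:R * (l2 * A + l2 * (e * B) + l2 * D) by ring.
by rewrite eV; lra.
Qed.

End StateNorm.

Section CurvesOfStates.
Variables (K : realType) (lambda eps : K).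
Implicit Types (y : K -> 'cV[K]_(4 + 3 + 4)) (dy : 'cV[K]_(4 + 3 + 4)).

Lemma derive_coords_usubmx m n (x : K -> 'cV[K]_(m + n)) (t : K) dx :
  derive_coords x t dx -> derive_coords (fun s => usubmx (x s)) t (usubmx dx).
Proof.
move=> hx i; rewrite mxE (_ : (fun s => _) = fun s => x s (lshift n i) 0); first exact: hx.
by apply/funext => s; rewrite mxE.
Qed.

Lemma derive_coords_dsubmx m n (x : K -> 'cV[K]_(m + n)) (t : K) dx :
  derive_coords x t dx -> derive_coords (fun s => dsubmx (x s)) t (dsubmx dx).
Proof.
move=> hx i; rewrite mxE (_ : (fun s => _) = fun s => x s (rshift m i) 0); first exact: hx.
by apply/funext => s; rewrite mxE.
Qed.

Lemma continuous_coords_usubmx m n (x : K -> 'cV[K]_(m + n)) :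
  continuous_coords x -> continuous_coords (fun s => usubmx (x s)).
Proof.
move=> hx i; rewrite (_ : (fun s => _) = fun s => x s (lshift n i) 0); first exact: hx.
by apply/funext => s; rewrite mxE.
Qed.

Lemma continuous_coords_dsubmx m n (x : K -> 'cV[K]_(m + n)) :
  continuous_coords x -> continuous_coords (fun s => dsubmx (x s)).
Proof.
move=> hx i; rewrite (_ : (fun s => _) = fun s => x s (rshift m i) 0); first exact: hx.
by apply/funext => s; rewrite mxE.
Qed.

Section Derive.
Variables (y : K -> 'cV[K]_(4 + 3 + 4)) (t : K) (dy : 'cV[K]_(4 + 3 + 4)).
Hypothesis hy : derive_coords y t dy.

Lemma derive_state_q : derive_coords (fun s => state_q (y s)) t (state_q dy).
Proof. exact: derive_coords_usubmx (derive_coords_usubmx hy). Qed.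

Lemma derive_attitude : derive_coords (fun s => attitude (y s)) t (attitude dy).
Proof. exact: (@derive_coords_usubmx 3 1 _ _ _ derive_state_q). Qed.

Lemma derive_rescaled_rate :
  derive_coords (fun s => rescaled_rate eps (y s)) t (rescaled_rate eps dy).
Proof. by apply: derive_coordsZ; exact: derive_coords_dsubmx (derive_coords_usubmx hy). Qed.

Lemma derive_filtered :
  derive_coords (fun s => filtered lambda eps (y s)) t (filtered lambda eps dy).
Proof.
apply: derive_coordsB; first exact: derive_state_q.
by apply: derive_coordsZ; exact: derive_coords_dsubmx hy.
Qed.

End Derive.

Section Continuity.
Variable y : K -> 'cV[K]_(4 + 3 + 4).
Hypothesis hy : continuous_coords y.

Lemma continuous_state_q : continuous_coords (fun s => state_q (y s)).
Proof. exact: continuous_coords_usubmx (continuous_coords_usubmx hy). Qed.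

Lemma continuous_attitude : continuous_coords (fun s => attitude (y s)).
Proof. exact: (@continuous_coords_usubmx 3 1 _ continuous_state_q). Qed.

Lemma continuous_rescaled_rate : continuous_coords (fun s => rescaled_rate eps (y s)).
Proof.
by apply: continuous_coordsZ; exact: continuous_coords_dsubmx (continuous_coords_usubmx hy).
Qed.

Lemma continuous_filtered : continuous_coords (fun s => filtered lambda eps (y s)).
Proof.
apply: continuous_coordsB; first exact: continuous_state_q.
by apply: continuous_coordsZ; exact: continuous_coords_dsubmx hy.
Qed.

Lemma continuous_full_sqdist : continuous (fun s => full_sqdist lambda eps (y s)).
Proof.
have cq : continuous_coords (fun s => state_q (y s) - qbar K).
  apply: continuous_coordsB; first exact: continuous_state_q.
  by move=> i s; exact: cvg_cst.
move=> s; apply: cvgD; last by apply: continuous_dot; exact: continuous_filtered.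
by apply: cvgD; apply: continuous_dot => //; exact: continuous_rescaled_rate.
Qed.

End Continuity.

End CurvesOfStates.

Section TrajectoryDecay.
Variables (K : realType) (Gm U : K -> 'M[K]_3) (G J : 'M[K]_3).
Variables (k1 k2 alpha lambda eps nu b0 kappa Jmin Jmax g g1 gm um r : K).
Hypotheses (k1_gt0 : 0 < k1) (k2_gt0 : 0 < k2) (alpha_gt0 : 0 < alpha) (lambda_gt0 : 0 < lambda).
Hypotheses (nu_gt0 : 0 < nu) (nu_le1 : nu <= 1) (eps_gt0 : 0 < eps) (eps_le1 : eps <= 1).
Hypotheses (Jmin_gt0 : 0 < Jmin) (Jmax_ge0 : 0 <= Jmax) (g_gt0 : 0 < g) (g1_ge0 : 0 <= g1).
Hypotheses (gm_ge0 : 0 <= gm) (um_ge0 : 0 <= um).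
Hypotheses (J_sym : J^T = J) (G_sym : G^T = G).
Hypothesis J_lower : forall u, Jmin * dot u u <= dot u (J *m u).
Hypothesis J_upper : forall u, enorm (J *m u) <= Jmax * enorm u.
Hypothesis G_lower : forall u, g * dot u u <= dot u (G *m u).
Hypothesis G_upper : forall u, enorm (G *m u) <= g1 * enorm u.
Hypothesis Gm_upper : forall t u, enorm (Gm t *m u) <= gm * enorm u.
Hypothesis U_upper : forall t u, enorm (U t *m u) <= um * enorm u.
Hypothesis dU : forall (t : K) i j, is_derive t 1 (fun s => U s i j) ((Gm t - G) i j).

Let c := k2 * alpha * lambda / 2%:R.
Let a := alpha * lambda.

(** These bound the quadratic remainder in J z', then, in the derivative of the
    Lyapunov function, the terms of order eps ^+ 2 and the cubic terms, and
    finally the Lyapunov function itself. *)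
Definition remainder_const := Jmax + gm * (147%:R * c + 48%:R * (k1 + c)).
Definition averaging_const :=
  ((gm * (k1 + c) + remainder_const) / Jmin + 6%:R + 2%:R * a) * um * (k1 + c)
  + 4%:R * um * (2%:R * k1 + c * (2%:R + a)).
Definition cubic_const :=
  4%:R * remainder_const + 2%:R * (k1 + c) * g1 + 2%:R + Jmax.
Definition upper_const := 4%:R * Jmax + (k1 + c) * g1 + 1 + 4%:R * um * (k1 + c).

Hypotheses (b0_gt0 : 0 < b0) (b0J : b0 <= Jmin / 2%:R) (b0v : b0 <= k1 * g) (b0p : b0 <= c * g).
Hypotheses (b01 : b0 <= 1) (nu_J : 3%:R * nu * Jmax <= b0 / 4%:R).
Hypothesis eps_b0 : 4%:R * eps * um * (k1 + c) <= b0 / 4%:R.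
Hypothesis nu_young :
  nu * (4%:R * a ^+ 2 * Jmax ^+ 2 / Jmin
        + (2%:R * k1 + c) ^+ 2 * g1 ^+ 2 / (2%:R * k1 * g) + 2%:R * c * g1) <= c * a * g.
Hypotheses (kappa_gt0 : 0 < kappa) (kappa_p : kappa <= c * a * g) (kappa_p4 : kappa <= 2%:R * a).
Hypotheses (kappa_z : kappa <= nu * Jmin / 4%:R) (kappa_v : kappa <= nu * k1 * g / 2%:R).
Hypothesis eps_kappa : eps * averaging_const <= kappa / 4%:R.
Hypotheses (r_gt0 : 0 < r) (r_le1 : r <= 1) (r_kappa : cubic_const * Num.sqrt r <= kappa / 4%:R).

Let c_gt0 : 0 < c. Proof. by rewrite divr_gt0// !mulr_gt0. Qed.
Let a_gt0 : 0 < a. Proof. exact: mulr_gt0. Qed.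

Lemma remainder_const_ge0 : 0 <= remainder_const.
Proof. by rewrite addr_ge0// mulr_ge0// !(addr_ge0, mulr_ge0)// ltW. Qed.

Lemma averaging_const_ge0 : 0 <= averaging_const.
Proof.
have Cr_ge0 := remainder_const_ge0.
by rewrite /averaging_const !(addr_ge0, mulr_ge0) ?invr_ge0// ltW.
Qed.

Lemma cubic_const_gt0 : 0 < cubic_const.
Proof.
have Cr_ge0 := remainder_const_ge0.
rewrite /cubic_const addrAC ltr_wpDl//.
by rewrite !(addr_ge0, mulr_ge0)// ltW.
Qed.

Lemma upper_const_gt0 : 0 < upper_const.
Proof.
rewrite /upper_const -addrA addrC -addrA ltr_pwDl//.
by rewrite !(addr_ge0, mulr_ge0)// ltW.
Qed.

Let V t x := lyap J G k1 c nu eps (U t) (attitude x) (rescaled_rate eps x)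
  (vpart (filtered lambda eps x)) (spart (filtered lambda eps x)).

Let V_bounds t x : enorm (state_q x) = 1 -> full_sqdist lambda eps x < r ->
  b0 / 4%:R * full_sqdist lambda eps x <= V t x /\
  V t x <= upper_const * error_sqdist lambda eps x.
Proof.
move=> q1 er; have [s0 Ee eE] := full_sqdist_bounds q1 (lt_le_trans er r_le1).
split; last first.
  exact: (lyap_le k1_gt0 c_gt0 nu_gt0 nu_le1 eps_gt0 eps_le1 Jmax_ge0 g1_ge0 um_ge0
    J_upper G_upper _ _ _ _ (U_upper t)).
apply: (@le_trans _ _ (b0 / 2%:R * error_sqdist lambda eps x)).
  have : b0 / 4%:R * full_sqdist lambda eps x <= b0 / 4%:R * (2%:R * error_sqdist lambda eps x).
    by rewrite ler_wpM2l// divr_ge0// ltW.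
  by lra.
by apply: (lyap_ge (Jmin := Jmin) (Jmax := Jmax) (g := g) (um := um)).
Qed.

Let V_rate (y : K -> 'cV[K]_(4 + 3 + 4)) t dy :
  derive_coords y t dy -> closed_loop Gm J k1 k2 alpha lambda eps t (y t) dy ->
  enorm (state_q (y t)) = 1 -> full_sqdist lambda eps (y t) < r ->
  exists2 dV, is_derive t 1 (fun s => V s (y s)) dV &
    dV <= - (eps * kappa / (2%:R * upper_const)) * V t (y t).
Proof.
move=> hy hcl q1 er; have [s0 Ee eE] := full_sqdist_bounds q1 (lt_le_trans er r_le1).
have E1 : error_sqdist lambda eps (y t) <= 1 by rewrite (le_trans Ee)// ltW// (lt_le_trans er).
have [r1 [r2 [r4 [[e1 e2 e3 e4] [n1 n2 n4]]]]] :=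
  closed_loop_error_dynamics k1_gt0 k2_gt0 alpha_gt0 lambda_gt0 eps_gt0 J_upper Gm_upper
    Jmax_ge0 gm_ge0 hcl q1 s0 E1.
have hf := derive_filtered lambda eps hy.
eexists.
  apply: (derive_lyap J G k1 c nu eps (dU t) (derive_attitude hy) (derive_rescaled_rate eps hy)).
    exact: (@derive_coords_usubmx K 3 1 _ _ _ hf).
  exact: (@derive_coords_dsubmx K 3 1 _ _ _ hf 0).
have rate := lyap_rate_le k1_gt0 c_gt0 a_gt0 nu_gt0 nu_le1 eps_gt0 Jmin_gt0 Jmax_ge0
  g1_ge0 gm_ge0 um_ge0 J_sym G_sym J_lower J_upper G_upper (U_upper t) (Gm_upper t)
  e1 e2 e3 e4 E1 n1 n2 n4 remainder_const_ge0
  (averaged_rate_le k1_gt0 c_gt0 a_gt0 nu_gt0 Jmin_gt0 g_gt0 J_lower J_upper G_lower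
     G_upper _ _ _ _ nu_young kappa_p kappa_p4 kappa_z kappa_v).
apply: (le_trans rate).
have [_ Vle] := V_bounds t q1 er.
set E := error_sqdist lambda eps (y t) in Ee E1 Vle *.
have E0 : 0 <= E.
  by rewrite /E /error_sqdist /sqdist !addr_ge0 ?dot_ge0 ?sqr_ge0.
rewrite -/averaging_const -/cubic_const.
have Er : Num.sqrt E <= Num.sqrt r by rewrite ler_wsqrtr// (le_trans Ee)// ltW.
have h3 : cubic_const * Num.sqrt E <= kappa / 4%:R.
  by apply: le_trans r_kappa; rewrite ler_wpM2l// ltW// cubic_const_gt0.
apply: (@le_trans _ _ (eps * E * (- (kappa / 2%:R)))).
  rewrite ler_wpM2l ?mulr_ge0 ?(ltW eps_gt0)//.
  by have := eps_kappa; lra.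
have u0 := upper_const_gt0.
have -> : eps * E * (- (kappa / 2%:R)) =
    - (eps * kappa / (2%:R * upper_const)) * (upper_const * E) by field; rewrite gt_eqF.
rewrite !mulNr lerN2 ler_wpM2l//.
by rewrite divr_ge0// mulr_ge0// ltW.
Qed.

Let U_continuous i j : continuous (fun t => U t i j).
Proof. by move=> t; exact: derive_pt_continuous (dU t i j). Qed.

(** The equations are only required while the trajectory has stayed in the
    region: this serves both for solutions and for the saturated system. *)
Lemma trajectory_decay (y : K -> 'cV[K]_(4 + 3 + 4)) t0 :
  continuous_coords y -> enorm (state_q (y t0)) = 1 ->
  (forall t : K, t0 < t ->
     (forall s, t0 <= s -> s <= t -> full_sqdist lambda eps (y s) < r) ->
     exists dy, derive_coords y t dy /\ closed_loop Gm J k1 k2 alpha lambda eps t (y t) dy) ->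
  full_sqdist lambda eps (y t0) < r ->
  upper_const * full_sqdist lambda eps (y t0) < b0 / 4%:R * r ->
  forall t, t0 <= t ->
  [/\ enorm (state_q (y t)) = 1, full_sqdist lambda eps (y t) < r &
    b0 / 4%:R * full_sqdist lambda eps (y t) <= upper_const * full_sqdist lambda eps (y t0)
      * expR (- (eps * kappa / (2%:R * upper_const)) * (t - t0))].
Proof.
move=> cy q1 hy er small.
have u0 := upper_const_gt0.
have sphere t : t0 <= t ->
    (forall s, t0 <= s -> s <= t -> full_sqdist lambda eps (y s) < r) ->
    enorm (state_q (y t)) = 1.
  move=> t0t es.
  have : `|dot (state_q (y t)) (state_q (y t)) - dot (state_q (y t0)) (state_q (y t0))| <= 0 - 0.
    apply: (@derive_norm_le _ (fun s => dot (state_q (y s)) (state_q (y s))) (fun=> 0)) => //.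
    - by apply: continuous_dot; exact: continuous_state_q.
    - by move=> s; exact: cvg_cst.
    - move=> s t0s st; have [|dy [hd [eq _ _]]] := hy s t0s.
        by move=> s' h1 h2; apply: es => //; rewrite (le_trans h2)// ltW.
      have hq := derive_state_q hd.
      exists (dot (state_q dy) (state_q (y s)) + dot (state_q (y s)) (state_q dy)), 0; split.
      + exact: derive_pt_dot.
      + exact: derive_pt_cst.
      + by rewrite (dotC (state_q dy)) eq dot_Wmx addr0 normr0.
  rewrite subrr normr_le0 subr_eq0 => /eqP qq.
  by rewrite /enorm qq -/(enorm _).
have cV : continuous (fun s => V s (y s)).
  have cf := @continuous_filtered K lambda eps y cy.
  apply: lyap_continuous => //.
  - exact: continuous_attitude.
  - exact: continuous_rescaled_rate.
  - exact: (@continuous_coords_usubmx K 3 1 _ cf).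
  - exact: (@continuous_coords_dsubmx K 3 1 _ cf 0).
have trap := @lyapunov_trap K (fun s => full_sqdist lambda eps (y s)) (fun s => V s (y s)) t0 r
  (b0 / 4%:R) upper_const (eps * kappa / (2%:R * upper_const))
  (continuous_full_sqdist (lambda := lambda) (eps := eps) cy) cV.
have {}trap t : t0 <= t -> full_sqdist lambda eps (y t) < r /\
    b0 / 4%:R * full_sqdist lambda eps (y t) <= upper_const * full_sqdist lambda eps (y t0)
      * expR (- (eps * kappa / (2%:R * upper_const)) * (t - t0)).
  apply: trap => //; [by rewrite divr_gt0|by rewrite divr_gt0// mulr_gt0| |].
  - move=> {}t t0t es; have qt := sphere t t0t es; have et := es t t0t (lexx t).
    have [l1 l2] := V_bounds t qt et.
    have [_ Ee _] := full_sqdist_bounds qt (lt_le_trans et r_le1).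
    split=> //; split; first by rewrite (le_trans l2)// ler_wpM2l// ltW.
    move=> {}t0t; have [dy [hd hcl]] := hy t t0t es.
    exact: V_rate hd hcl qt et.
  - by rewrite mulr_ge0 ?full_sqdist_ge0// ltW.
move=> t t0t; have [h1 h2] := trap t t0t; split => //.
by apply: sphere => // s t0s _; case: (trap s t0s).
Qed.

End TrajectoryDecay.

Section StabilityFromDecay.
Variables (K : realType) (Gm : K -> 'M[K]_3) (J : 'M[K]_3).
Variables (k1 k2 alpha lambda eps r a1 a2 gam : K).
Hypotheses (lambda_gt0 : 0 < lambda) (eps_gt0 : 0 < eps) (r_gt0 : 0 < r).
Hypotheses (a1_gt0 : 0 < a1) (a2_gt0 : 0 < a2) (gam_gt0 : 0 < gam).
Hypothesis J_unit : J \in unitmx.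
Hypothesis Gm_continuous : forall i j, continuous (fun t => Gm t i j).
Hypothesis Gm_bounded : forall i j, exists b, forall t, `|Gm t i j| <= b.
Hypothesis decay : forall (y : K -> 'cV[K]_(4 + 3 + 4)) t0,
  continuous_coords y -> enorm (state_q (y t0)) = 1 ->
  (forall t : K, t0 < t ->
     (forall s, t0 <= s -> s <= t -> full_sqdist lambda eps (y s) < r) ->
     exists dy, derive_coords y t dy /\ closed_loop Gm J k1 k2 alpha lambda eps t (y t) dy) ->
  full_sqdist lambda eps (y t0) < r -> a2 * full_sqdist lambda eps (y t0) < a1 * r ->
  forall t, t0 <= t ->
  [/\ enorm (state_q (y t)) = 1, full_sqdist lambda eps (y t) < r &
    a1 * full_sqdist lambda eps (y t) <=
      a2 * full_sqdist lambda eps (y t0) * expR (- gam * (t - t0))].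

Let xbar := state (qbar K) 0 ((eps * lambda)^-1 *: qbar K).
Let F := closed_loop Gm J k1 k2 alpha lambda eps.
Let kE := 1 + eps ^+ 2 + 2%:R / (eps * lambda) ^+ 2.
Let kF := 3%:R + eps ^- 2 + 2%:R * (eps * lambda) ^+ 2.

Let kE_gt0 : 0 < kE.
Proof. by rewrite /kE -addrA ltr_pwDl// addr_ge0 ?divr_ge0 ?sqr_ge0. Qed.

Let kF_gt0 : 0 < kF.
Proof.
rewrite /kF -addrA ltr_pwDl//; apply: addr_ge0; first by rewrite invr_ge0 sqr_ge0.
by rewrite mulr_ge0// sqr_ge0.
Qed.

(** The box contains the region to which the decay estimate confines the
    solution, so that the saturation is never active along it. *)
Lemma exists_solution t0 x0 : enorm (state_q x0) = 1 ->
  full_sqdist lambda eps x0 < r -> a2 * full_sqdist lambda eps x0 < a1 * r ->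
  exists x, solution F (@state_space K) t0 x0 x.
Proof.
move=> q1 er small.
pose box := Num.sqrt (kE * r) + enorm xbar.
have box_ge0 : 0 <= box by rewrite addr_ge0 ?sqrtr_ge0 ?enorm_ge0.
have in_box x : full_sqdist lambda eps x < r -> saturate box x = x.
  move=> ex; apply: saturate_id => i; apply: (le_trans (coord_le_enorm x i)).
  rewrite -{1}(subrK xbar x); apply: enormD_le => //.
  rewrite ler_wsqrtr//; apply: (le_trans (error_le_full_sqdist lambda_gt0 eps_gt0 x)).
  by rewrite ler_wpM2l ?(ltW kE_gt0)// ltW.
have [y [y0 cy dy]] := exists_saturated_solution t0 x0
  (closed_loop_field_regular J k1 k2 alpha lambda eps box_ge0 Gm_continuous Gm_bounded).
have field_y (t : K) : t0 < t -> full_sqdist lambda eps (y t) < r ->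
    derive_coords y t (closed_loop_field Gm J k1 k2 alpha lambda eps t (y t)).
  by move=> t0t et i; have := dy t t0t i; rewrite in_box.
have dec : forall t, t0 <= t ->
    enorm (state_q (y t)) = 1 /\ full_sqdist lambda eps (y t) < r.
  move=> t t0t; have [| | | |? ? _ //] := decay cy _ _ _ _ t0t; rewrite ?y0//.
  move=> s t0s es; exists (closed_loop_field Gm J k1 k2 alpha lambda eps s (y s)).
  split; first by apply: field_y => //; exact: es (ltW t0s) (lexx s).
  exact: closed_loop_fieldP.
exists y; split=> //.
- by apply: continuous_subspaceT; exact: continuous_of_coords.
- by move=> t /dec[].
- move=> t t0t; have [_ et] := dec t (ltW t0t).
  have [dry ->] := is_derive_of_coords (field_y t t0t et).
  by split=> //; exact: closed_loop_fieldP.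
Qed.

(** Freezing a solution before t0 makes it continuous on the whole line. *)
Lemma solution_decay t0 x0 x : state_space x0 ->
  full_sqdist lambda eps x0 < r -> a2 * full_sqdist lambda eps x0 < a1 * r ->
  solution F (@state_space K) t0 x0 x -> forall t, t0 <= t ->
  a1 * full_sqdist lambda eps (x t) <=
    a2 * full_sqdist lambda eps x0 * expR (- gam * (t - t0)).
Proof.
move=> q1 er small [x_t0 cx _ dx] t t0t.
pose y s := x (Num.max s t0).
have yx s : t0 <= s -> y s = x s by move=> t0s; rewrite /y max_l.
have y0 : y t0 = x0 by rewrite yx.
have [| | | |_ _] := decay (within_continuous_clamp cx) _ _ _ _ t0t;
  rewrite -/(y t) -/(y t0) ?y0//; last by rewrite yx.
move=> s t0s _; have [drx Fx] := dx s t0s; exists ('D_1 x s).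
rewrite -/(y s) yx ?(ltW t0s)//; split=> // i.
apply: (near_eq_is_derive _ (is_derive_coords drx i)).
near=> u; rewrite max_l//; apply: ltW; near: u; exact: lt_nbhsr.
Unshelve. all: by end_near. Qed.

Lemma stability_of_decay : locally_exponentially_stable F (@state_space K) xbar.
Proof.
pose rho := Num.min r (a1 * r / a2).
have rho_gt0 : 0 < rho by rewrite lt_min r_gt0 divr_gt0// mulr_gt0.
pose k := Num.sqrt (kE * (a2 / a1 * kF)).
have kk : 0 < kE * (a2 / a1 * kF) by rewrite !mulr_gt0// ?invr_gt0.
exists (Num.sqrt (rho / kF)), k, (gam / 2%:R); split.
- by rewrite sqrtr_gt0 divr_gt0.
- by rewrite sqrtr_gt0.
- by rewrite divr_gt0.
move=> t0 x0 _ q1 near0.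
have e_rho : full_sqdist lambda eps x0 < rho.
  apply: (le_lt_trans (full_sqdist_le_error lambda_gt0 eps_gt0 x0)).
  rewrite -/xbar -/kF -sqr_enorm mulrC -ltr_pdivlMr//.
  rewrite -[ltRHS]sqr_sqrtr ?divr_ge0 ?(ltW rho_gt0) ?(ltW kF_gt0)//.
  by rewrite ltr_pXn2r ?nnegrE ?enorm_ge0 ?sqrtr_ge0.
have er : full_sqdist lambda eps x0 < r by rewrite (lt_le_trans e_rho)// ge_min lexx.
have small : a2 * full_sqdist lambda eps x0 < a1 * r.
  rewrite mulrC -ltr_pdivlMr//; apply: (lt_le_trans e_rho).
  by rewrite ge_min lexx orbT.
split; first exact: exists_solution.
move=> x solx t t0t; have dec := solution_decay q1 er small solx t0t.
apply: enorm_le_sqr.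
  by rewrite !mulr_ge0 ?expR_ge0 ?enorm_ge0 ?sqrtr_ge0.
apply: (le_trans (error_le_full_sqdist lambda_gt0 eps_gt0 (x t))); rewrite -/kE.
rewrite !exprMn sqr_sqrtr ?(ltW kk)// sqr_enorm.
have -> : expR (- (gam / 2%:R) * (t - t0)) ^+ 2 = expR (- gam * (t - t0)).
  by rewrite -expRM_natl; congr expR; field.
set E := expR _ in dec *.
rewrite -!mulrA ler_wpM2l ?(ltW kE_gt0)//.
rewrite mulrC in dec; rewrite -ler_pdivlMr// in dec; apply: (le_trans dec).
have h := full_sqdist_le_error lambda_gt0 eps_gt0 x0; rewrite -/xbar -/kF in h.
have -> : a2 * full_sqdist lambda eps x0 * E / a1 = a2 / a1 * (full_sqdist lambda eps x0 * E).
  by ring.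
rewrite [leRHS](_ : _ = a2 / a1 * (kF * dot (x0 - xbar) (x0 - xbar) * E)); last by ring.
rewrite ler_wpM2l ?divr_ge0 ?(ltW a1_gt0) ?(ltW a2_gt0)//.
by rewrite ler_wpM2r// expR_ge0.
Qed.

End StabilityFromDecay.

Lemma exists_pos_le2 (K : realType) (x y : K) : 0 < x -> 0 < y ->
  exists m, [/\ 0 < m, m <= x & m <= y].
Proof.
by move=> x0 y0; exists (Num.min x y); rewrite lt_min x0 y0 !ge_min !lexx orbT.
Qed.

Theorem theorem7 (K : realType) (o : orbit_dipole K)
    (Jmin Jmax k1 k2 alpha lambda : K)
    (Jmin_gt0 : 0 < Jmin) (Jmin_le_Jmax : Jmin <= Jmax)
    (k1_gt0 : 0 < k1) (k2_gt0 : 0 < k2)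
    (alpha_gt0 : 0 < alpha) (lambda_gt0 : 0 < lambda)
    (Gamma_av_posdef : posdef (Gamma_av o)) :
  exists2 eps_star : K, 0 < eps_star &
    forall (J : 'M[K]_3) (eps : K),
      posdef J ->
      Jmin <= lambda_min J -> lambda_min J <= lambda_max J ->
      lambda_max J = opnorm J -> opnorm J <= Jmax ->
      0 < eps -> eps < eps_star ->
      locally_exponentially_stable
        (closed_loop (Gamma o) J k1 k2 alpha lambda eps)
        (@state_space K)
        (state (qbar K) 0 ((eps * lambda)^-1 *: qbar K)).
Proof.
have [G_sym _] := Gamma_av_posdef.
have [g g_gt0 G_lower] := posdef_coercive Gamma_av_posdef.
have [g1 g1_ge0 G_upper] := enorm_mulmx_bound (Gamma_av o).
have [gm gm_ge0 Gm_upper] := Gamma_bounded o.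
have [U [[um um_ge0 U_upper] dU]] := Gamma_deviation_primitive o.
have Jmax_gt0 := lt_le_trans Jmin_gt0 Jmin_le_Jmax; have Jmax_ge0 := ltW Jmax_gt0.
pose c := k2 * alpha * lambda / 2%:R; pose a := alpha * lambda.
have c_gt0 : 0 < c by rewrite divr_gt0// !mulr_gt0.
have a_gt0 : 0 < a by exact: mulr_gt0.
(* b0 bounds the energy from below *)
have [b1 [b1_gt0 b1J b1v]] := exists_pos_le2
  (divr_gt0 Jmin_gt0 (ltr0Sn K 1)) (mulr_gt0 k1_gt0 g_gt0).
have [b2 [b2_gt0 b2p b21]] := exists_pos_le2 (mulr_gt0 c_gt0 g_gt0) (@ltr01 K).
have [b0 [b0_gt0 b0b1 b0b2]] := exists_pos_le2 b1_gt0 b2_gt0.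
pose young_const := 4%:R * a ^+ 2 * Jmax ^+ 2 / Jmin
  + (2%:R * k1 + c) ^+ 2 * g1 ^+ 2 / (2%:R * k1 * g) + 2%:R * c * g1.
have young_gt0 : 0 < young_const.
  rewrite /young_const -addrA ltr_pwDl//.
    by rewrite divr_gt0// !mulr_gt0// exprn_gt0.
  apply: addr_ge0; last by rewrite !mulr_ge0// ltW.
  apply: divr_ge0; first by apply: mulr_ge0; exact: sqr_ge0.
  by rewrite ltW// !mulr_gt0.
(* nu is fixed first, from the gains and the bounds on J and G; it determines the
   damping kappa, against which the radius r and eps_star are then chosen *)
have [nu1 [nu1_gt0 nu1J nu1y]] := exists_pos_le2
  (divr_gt0 b0_gt0 (mulr_gt0 (ltr0Sn K 11) Jmax_gt0))
  (divr_gt0 (mulr_gt0 (mulr_gt0 c_gt0 a_gt0) g_gt0) young_gt0).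
have [nu [nu_gt0 nu_le1 nu_nu1]] := exists_pos_le2 (@ltr01 K) nu1_gt0.
have [m1 [m1_gt0 m1p m1p4]] := exists_pos_le2 (mulr_gt0 (mulr_gt0 c_gt0 a_gt0) g_gt0)
  (mulr_gt0 (ltr0Sn K 1) a_gt0).
have [m2 [m2_gt0 m2z m2v]] := exists_pos_le2 (divr_gt0 (mulr_gt0 nu_gt0 Jmin_gt0) (ltr0Sn K 3))
  (divr_gt0 (mulr_gt0 (mulr_gt0 nu_gt0 k1_gt0) g_gt0) (ltr0Sn K 1)).
have [kappa [kappa_gt0 kappa_m1 kappa_m2]] := exists_pos_le2 m1_gt0 m2_gt0.
pose C2 := averaging_const k1 k2 alpha lambda Jmin Jmax gm um.
pose C3 := cubic_const k1 k2 alpha lambda Jmax g1 gm.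
have C2_ge0 : 0 <= C2 by exact: averaging_const_ge0.
have C3_gt0 : 0 < C3 by exact: cubic_const_gt0.
have kC3 : 0 < kappa / (4%:R * C3) by rewrite divr_gt0// mulr_gt0.
have [r [r_gt0 r_le1 r_le]] := exists_pos_le2 (@ltr01 K) (exprn_gt0 2 kC3).
pose S := um * (k1 + c).
have S_ge0 : 0 <= S by rewrite mulr_ge0// addr_ge0// ltW.
have [e1 [e1_gt0 e1b e1k]] := exists_pos_le2
  (divr_gt0 b0_gt0 (mulr_gt0 (ltr0Sn K 15) (ltr_wpDl S_ge0 (@ltr01 K))))
  (divr_gt0 kappa_gt0 (mulr_gt0 (ltr0Sn K 3) (ltr_wpDl C2_ge0 (@ltr01 K)))).
have [eps_star [eps_star_gt0 eps_star1 eps_star_e1]] := exists_pos_le2 (@ltr01 K) e1_gt0.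
exists eps_star => // J eps Jpd Jlo _ _ Jhi eps_gt0 eps_lt.
have [J_sym _] := Jpd.
have J_lower u : Jmin * dot u u <= dot u (J *m u).
  apply: le_trans (lambda_min_le_rayleigh Jpd u).
  by rewrite ler_wpM2r// dot_ge0.
have J_upper u : enorm (J *m u) <= Jmax * enorm u.
  by apply: (le_trans (enorm_le_opnorm J u)); rewrite ler_wpM2r// enorm_ge0.
have J_unit : J \in unitmx := sym_injective_unitmx J_sym (posdef_injective Jpd).
have eps_e1 : eps <= e1 by rewrite (le_trans (ltW eps_lt)).
have u_gt0 := upper_const_gt0 k1_gt0 k2_gt0 alpha_gt0 lambda_gt0 Jmax_ge0 g1_ge0 um_ge0.
have b04 : 0 < b0 / 4%:R by rewrite divr_gt0.
have gam_gt0 := divr_gt0 (mulr_gt0 eps_gt0 kappa_gt0) (mulr_gt0 (ltr0Sn K 1) u_gt0).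
apply: (stability_of_decay lambda_gt0 eps_gt0 r_gt0 b04 u_gt0 gam_gt0 J_unit).
- exact: Gamma_continuous.
- by move=> i j; have [b _ hb] := trigpoly_bounded (Gamma_trigpoly o i j); exists b.
apply: (trajectory_decay k1_gt0 k2_gt0 alpha_gt0 lambda_gt0 nu_gt0 nu_le1 eps_gt0 _ Jmin_gt0
  Jmax_ge0 g_gt0 g1_ge0 gm_ge0 um_ge0 J_sym G_sym J_lower J_upper G_lower G_upper Gm_upper
  U_upper dU b0_gt0 (le_trans b0b1 b1J) (le_trans b0b1 b1v) (le_trans b0b2 b2p)
  (le_trans b0b2 b21) _ _ _ kappa_gt0 (le_trans kappa_m1 m1p) (le_trans kappa_m1 m1p4)
  (le_trans kappa_m2 m2z) (le_trans kappa_m2 m2v) _ r_le1 _).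
- by rewrite (le_trans (ltW eps_lt)).
- have := le_trans nu_nu1 nu1J; rewrite ler_pdivlMr ?mulr_gt0//.
  by lra.
- have := le_trans eps_e1 e1b; rewrite ler_pdivlMr ?mulr_gt0 ?ltr_wpDl//.
  have := mulr_ge0 (ltW eps_gt0) S_ge0; rewrite /S -/c.
  by have := eps_gt0; lra.
- have := le_trans nu_nu1 nu1y; rewrite ler_pdivlMr//.
- have := le_trans eps_e1 e1k; rewrite ler_pdivlMr ?mulr_gt0 ?ltr_wpDl//.
  by rewrite -/C2; have := eps_gt0; lra.
- rewrite -/C3 mulrC -ler_pdivlMr//.
  apply: (@le_trans _ _ (kappa / (4%:R * C3))).
    by rewrite -[leRHS]ger0_norm ?(ltW kC3)// -sqrtr_sqr ler_wsqrtr.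
  by rewrite le_eqVlt; apply/orP; left; apply/eqP; field; rewrite gt_eqF.
Qed.
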